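(* Let $\mathcal K\subset\mathbb{R}^m$ be the $m$-dimensional second-order cone and let $\Omega=\{(x,y):x\in\mathcal K,\ y\in\mathcal K,\ x^Ty=0\}$ be the second-order cone complementarity set. Then $\Omega$ is directionally regular. For any $(x,y)\in\Omega$ and $(d,w)\in T_\Omega(x,y)=T^i_\Omega(x,y)$, the directional normal cone is as follows. Case 1: $x=0$, $y\in\mathrm{int}\,\mathcal K$: $N_\Omega((x,y);(d,w))=N_\Omega(x,y)=\mathbb{R}^m\times\{0\}$. Case 2: $x\in\mathrm{int}\,\mathcal K$, $y=0$: $N_\Omega((x,y);(d,w))=N_\Omega(x,y)=\{0\}\times\mathbb{R}^m$. Case 3: $x,y\in\mathrm{bd}\,\mathcal K\setminus\{0\}$: $N_\Omega((x,y);(d,w))=N_\Omega(x,y)$. Case 4: $x\in\mathrm{bd}\,\mathcal K\setminus\{0\}$, $y=0$: $$N_\Omega((x,y);(d,w))=\begin{cases}\{(u,v):u=0,\ v\in\mathbb{R}^m\}&\text{if } d\in\mathrm{int}\,T_{\mathcal K}(x),\ w=0,\\ N_\Omega(x,y)&\text{if } d\in\mathrm{bd}\,T_{\mathcal K}(x),\ w=0,\\ \{(u,v):u\in\mathbb{R}\hat x,\ v\perp\hat x\}&\text{if } d\perp\hat x,\ w\in\mathbb{R}_+\hat x\setminus\{0\}.\end{cases}$$ Case 5: $x=0$, $y\in\mathrm{bd}\,\mathcal K\setminus\{0\}$: $$N_\Omega((x,y);(d,w))=\begin{cases}\{(u,v):u\in\mathbb{R}^m,\ v=0\}&\text{if }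 d=0,\ w\in\mathrm{int}\,T_{\mathcal K}(y),\\ N_\Omega(x,y)&\text{if } d=0,\ w\in\mathrm{bd}\,T_{\mathcal K}(y),\\ \{(u,v):v\in\mathbb{R}\hat y,\ u\perp\hat y\}&\text{if } d\in\mathbb{R}_+\hat y\setminus\{0\},\ w\perp\hat y.\end{cases}$$ Case 6: $x=0$, $y=0$: $N_\Omega((x,y);(d,w))=N_\Omega(d,w)$.
   Context: $\mathcal K=\{(x_1,x_2)\in\mathbb{R}\times\mathbb{R}^{m-1}:x_1\ge\|x_2\|\}$ ($\mathcal K=\mathbb{R}_+$ if $m=1$). For $z=(z_1,z_2)\in\mathbb{R}\times\mathbb{R}^{m-1}$, $\hat z=(z_1,-z_2)$. $\mathbb{R}x=\{tx:t\in\mathbb{R}\}$, $\mathbb{R}_+x=\{tx:t\ge0\}$; int and bd denote interior and boundary. For $C\subseteq\mathbb{R}^n$ and $z\in C$: $T_C(z)=\{u:\exists t_k\downarrow 0,\ u_k\to u \text{ with } z+t_ku_k\in C\ \forall k\}$, $T^i_C(z)=\{u:\forall t_k\downarrow 0,\ \exists u_k\to u \text{ with } z+t_ku_k\in C\ \forall k\}$ ($t_k\downarrow0$ means $t_k>0$, $t_k\to0$). The regular normal cone is $\widehat N_C(z)=\{v:\langle v,z'-z\rangle\le o(\|z'-z\|)\ \forall z'\in C\}$ for $z\in C$ and $\emptyset$ for $z\notin C$. The limiting normal cone is $N_C(z)=\{\lim v_k: v_k\in\widehat N_C(z_k),\ z_k\in C,\ z_k\to z\}$. The directional limiting normal cone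 is $N_C(z;d)=\{v:\exists t_k\downarrow0,\ d_k\to d,\ v_k\to v\text{ with }v_k\in\widehat N_C(z+t_kd_k)\ \forall k\}$; the inner one is $N^i_C(z;d)=\{v:\forall t_k\downarrow0\ \exists d_k\to d,\ v_k\to v\text{ with }v_k\in\widehat N_C(z+t_kd_k)\ \forall k\}$. $C$ is directionally regular if $N_C(z;d)=N_C^i(z;d)$ for all $z\in C$ and all $d\in\mathbb{R}^n$. *)

(* Defs.v *)
From mathcomp Require Import all_boot all_order all_algebra.
From mathcomp Require Import all_classical all_reals all_analysis.
Set Implicit Arguments.
Unset Strict Implicit.
Unset Printing Implicit Defensive.
Import Order.TTheory GRing.Theory Num.Theory.
Import numFieldNormedType.Exports.
Local Open Scope classical_set_scope.
Local Open Scope ring_scope.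

Section Euclidean.
Variables (R : realType) (n : nat).
Implicit Types u v x : 'rV[R]_n.

Definition dot u v : R := (u *m v^T) 0 0.

(* The library norm on matrices is the sup norm; the topology is the same. *)
Definition enorm u : R := Num.sqrt (dot u u).

Definition orth u v : Prop := dot u v = 0.

Definition line x : set 'rV[R]_n := [set t *: x | t in [set: R]].

Definition ray x : set 'rV[R]_n := [set t *: x | t in [set t : R | 0 <= t]].

End Euclidean.

Definition bd (T : topologicalType) (A : set T) : set T := closure A `\` A°.

Section VariationalCones.
Variables (R : realType) (n : nat) (C : set 'rV[R]_n).
Implicit Types z d : 'rV[R]_n.

(* t_k > 0 and t_k -> 0; no monotonicity is required. *)
Definition down0 (t : nat -> R) : Prop :=
  (forall k, 0 < t k) /\ t @ \oo --> (0 : R).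

Definition tangent_cone z : set 'rV[R]_n :=
  [set u | exists t (u_ : nat -> 'rV[R]_n),
     [/\ down0 t, u_ @ \oo --> u & forall k, C (z + t k *: u_ k)]].

Definition inner_tangent_cone z : set 'rV[R]_n :=
  [set u | forall t, down0 t -> exists u_ : nat -> 'rV[R]_n,
     u_ @ \oo --> u /\ forall k, C (z + t k *: u_ k)].

Definition regular_normal_cone z : set 'rV[R]_n :=
  [set v | C z /\ forall e : R, 0 < e ->
     \forall z' \near z, C z' -> dot v (z' - z) <= e * enorm (z' - z)].

Definition limiting_normal_cone z : set 'rV[R]_n :=
  [set v | exists z_ v_ : nat -> 'rV[R]_n,
     [/\ z_ @ \oo --> z, v_ @ \oo --> v, forall k, C (z_ k)
       & forall k, regular_normal_cone (z_ k) (v_ k)]].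

Definition dir_normal_cone z d : set 'rV[R]_n :=
  [set v | exists t (d_ v_ : nat -> 'rV[R]_n),
     [/\ down0 t, d_ @ \oo --> d, v_ @ \oo --> v
       & forall k, regular_normal_cone (z + t k *: d_ k) (v_ k)]].

Definition inner_dir_normal_cone z d : set 'rV[R]_n :=
  [set v | forall t, down0 t -> exists d_ v_ : nat -> 'rV[R]_n,
     [/\ d_ @ \oo --> d, v_ @ \oo --> v
       & forall k, regular_normal_cone (z + t k *: d_ k) (v_ k)]].

Definition directionally_regular : Prop :=
  forall z d, C z -> dir_normal_cone z d = inner_dir_normal_cone z d.

End VariationalCones.

Section SecondOrderCone.
Variables (R : realType) (n : nat).

(* The dimension is m = n.+1 >= 1, and R^m = R x R^(m-1) is 'rV[R]_(1 + n),
   which is convertible to 'rV[R]_n.+1.  For n = 0 the second component is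
   empty, has norm 0, and the cone is R_+. *)
Definition soc : set 'rV[R]_n.+1 :=
  [set x : 'rV[R]_(1 + n) | enorm (rsubmx x) <= lsubmx x 0 0].

Definition hat (z : 'rV[R]_n.+1) : 'rV[R]_n.+1 :=
  row_mx (lsubmx (z : 'rV[R]_(1 + n))) (- rsubmx (z : 'rV[R]_(1 + n))).

(* {(x, y) | P x y} as a subset of R^(2m); the pair (x, y) is row_mx x y. *)
Definition pairset (P : 'rV[R]_n.+1 -> 'rV[R]_n.+1 -> Prop) :
    set 'rV[R]_(n.+1 + n.+1) :=
  [set z | P (lsubmx z) (rsubmx z)].

Definition soc_compl : set 'rV[R]_(n.+1 + n.+1) :=
  pairset (fun x y => [/\ soc x, soc y & dot x y = 0]).

End SecondOrderCone.

(* Main.v *)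
Require Import Defs.
From mathcomp Require Import all_boot all_order all_algebra.
From mathcomp Require Import all_classical all_reals all_analysis.
From mathcomp Require Import ring lra.
Set Implicit Arguments.
Unset Strict Implicit.
Unset Printing Implicit Defensive.
Import Order.TTheory GRing.Theory Num.Theory.
Import numFieldNormedType.Exports.
Local Open Scope classical_set_scope.
Local Open Scope ring_scope.

(* Write [qf x = <x, hat x>], so that the cone is [hd x >= 0, qf x >= 0].  The
   identity [complementarity_gap] shows that over [hd x > 0] the set Omega
   consists of the pairs [(x, s hat x)] with [s >= 0], [qf x >= 0] and
   [s * qf x = 0].  In this chart there are three strata, and the regular normal
   cone is
     - [u = 0] if [qf x > 0] (so [s = 0]);
     - [v _|_ hat x], [u + s hat v] in [R hat x] if [qf x = 0 < s], where Omega is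
       a smooth manifold ([smooth_normal]);
     - [u] in [- R_+ hat x], [<v, hat x> <= 0] if [qf x = 0 = s]
       ([corner_normal]).
   Each of the three conditions is closed, which bounds the (directional)
   limiting cones from above.  Conversely, along any [t_k], explicit paths inside
   each stratum with prescribed direction carry normals converging to a given
   one, so the bounds are attained by the inner cone.  The part [hd y > 0] is
   symmetric, and at the origin Omega is a cone.  Finally, [d] is tangent
   (inner tangent) iff [0] is a directional (inner directional) normal along
   [d], so directional regularity gives T = T^i. *)

(** * Inner product and Euclidean norm of row vectors *)

Section DotAlgebra.
Context {R : realType} {p : nat}.
Implicit Types (a : R) (u v w : 'rV[R]_p).

Lemma dotC u v : dot u v = dot v u.
Proof. by rewrite /dot -[in LHS](trmxK u) -trmx_mul mxE. Qed.

Lemma dotDl u v w : dot (u + v) w = dot u w + dot v w.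
Proof. by rewrite /dot mulmxDl mxE. Qed.

Lemma dotZl a u w : dot (a *: u) w = a * dot u w.
Proof. by rewrite /dot -scalemxAl mxE. Qed.

Lemma dotNl u w : dot (- u) w = - dot u w.
Proof. by rewrite -scaleN1r dotZl mulN1r. Qed.

Lemma dot0l w : dot 0 w = 0.
Proof. by rewrite -(scale0r 0) dotZl mul0r. Qed.

Lemma dotDr u v w : dot w (u + v) = dot w u + dot w v.
Proof. by rewrite !(dotC w) dotDl. Qed.

Lemma dotZr a u w : dot w (a *: u) = a * dot w u.
Proof. by rewrite !(dotC w) dotZl. Qed.

Lemma dotNr u w : dot w (- u) = - dot w u.
Proof. by rewrite !(dotC w) dotNl. Qed.

Lemma dot0r w : dot w 0 = 0.
Proof. by rewrite dotC dot0l. Qed.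

Definition dotE := (dotDl, dotDr, dotNl, dotNr, dotZl, dotZr, dot0l, dot0r).

Lemma dot_sum u v : dot u v = \sum_j u 0 j * v 0 j.
Proof. by rewrite /dot mxE; apply: eq_bigr => j _; rewrite mxE. Qed.

Lemma dot_ge0 u : 0 <= dot u u.
Proof. by rewrite dot_sum sumr_ge0// => j _; rewrite -expr2 sqr_ge0. Qed.

Lemma dot_eq0 u : dot u u = 0 -> u = 0.
Proof.
rewrite dot_sum => /eqP; rewrite psumr_eq0; last first.
  by move=> j _; rewrite -expr2 sqr_ge0.
move=> /allP u0; apply/rowP => j; rewrite mxE.
by have /(_ (mem_index_enum j)) := u0 j; rewrite /= mulf_eq0 orbb => /eqP.
Qed.

Lemma dot_gt0 u : u != 0 -> 0 < dot u u.
Proof.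
by move=> u0; rewrite lt_def dot_ge0 andbT; apply: contra_neq u0 => /dot_eq0.
Qed.

(** Cauchy-Schwarz: the squared norm of [<v, v> u - <u, v> v] is [<v, v>] times the difference of
    the two sides. *)
Lemma dot_sqr_le u v : dot u v ^+ 2 <= dot u u * dot v v.
Proof.
have [->|v0] := eqVneq v 0; first by rewrite !dotE expr0n mulr0.
have vv := dot_gt0 v0.
have := dot_ge0 (dot v v *: u - dot u v *: v).
rewrite !dotE (dotC v u) => h.
rewrite -subr_ge0 -(pmulr_rge0 _ vv); apply: le_trans h _.
by rewrite le_eqVlt; apply/orP; left; apply/eqP; ring.
Qed.

Lemma enorm_ge0 u : 0 <= enorm u.
Proof. exact: sqrtr_ge0. Qed.

Lemma enorm_sqr u : enorm u ^+ 2 = dot u u.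
Proof. by rewrite sqr_sqrtr ?dot_ge0. Qed.

Lemma enorm0 : enorm (0 : 'rV[R]_p) = 0.
Proof. by rewrite /enorm dotE sqrtr0. Qed.

Lemma enormZ a u : enorm (a *: u) = `|a| * enorm u.
Proof. by rewrite /enorm !dotE mulrA -expr2 sqrtrM ?sqr_ge0// sqrtr_sqr. Qed.

Lemma normr_dot_le u v : `|dot u v| <= enorm u * enorm v.
Proof.
rewrite -ler_sqr ?nnegrE ?mulr_ge0 ?enorm_ge0//.
by rewrite real_normK ?num_real// exprMn !enorm_sqr dot_sqr_le.
Qed.

End DotAlgebra.

(** * Limits of linear, bilinear and norm expressions along a filter *)

Section Cvg.
Context {R : realType} {T : Type} {F : set_system T} {FF : Filter F}.

Lemma cvg_near {V : topologicalType} (f : T -> V) (a : V) (P : V -> Prop) :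
  f @ F --> a -> (\forall z \near a, P z) -> \forall k \near F, P (f k).
Proof. by move=> cf; exact: cf. Qed.

Lemma cvg_add {V : normedModType R} (f g : T -> V) (a b : V) :
  f @ F --> a -> g @ F --> b -> (fun k => f k + g k) @ F --> a + b.
Proof. exact: cvgD. Qed.

Lemma cvg_opp {V : normedModType R} (f : T -> V) (a : V) :
  f @ F --> a -> (fun k => - f k) @ F --> - a.
Proof. exact: cvgN. Qed.

Lemma cvg_mul (f g : T -> R) (a b : R) :
  f @ F --> a -> g @ F --> b -> (fun k => f k * g k) @ F --> a * b.
Proof. exact: cvgM. Qed.

Lemma cvg_sum {V : normedModType R} (I : Type) (r : seq I) (f : I -> T -> V)
    (a : I -> V) : (forall i, f i @ F --> a i) ->
  (fun k => \sum_(i <- r) f i k) @ F --> \sum_(i <- r) a i.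
Proof.
move=> cf; elim: r => [|i r IH].
  rewrite big_nil; under eq_fun do rewrite big_nil.
  exact: cvg_cst.
by rewrite big_cons; under eq_fun do rewrite big_cons; exact: cvg_add.
Qed.

Lemma cvg_coord p (u_ : T -> 'rV[R]_p) (u : 'rV[R]_p) j :
  u_ @ F --> u -> (fun k => u_ k 0 j) @ F --> u 0 j.
Proof.
by move=> cu; apply: (continuous_cvg _ (@coord_continuous R 1 p 0 j u)).
Qed.

(** Expansion in the basis [delta_mx 0 j] turns [f] into a finite sum of coordinates times fixed
    vectors, so coordinatewise convergence suffices. *)
Lemma cvg_linear p {V : normedModType R} (f : {linear 'rV[R]_p -> V})
    (u_ : T -> 'rV[R]_p) (u : 'rV[R]_p) : u_ @ F --> u -> (fun k => f (u_ k)) @ F --> f u.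
Proof.
move=> cu.
have fE v : f v = \sum_j v 0 j *: f (delta_mx 0 j).
  by rewrite {1}[v]row_sum_delta linear_sum; apply: eq_bigr => j _; rewrite linearZ.
rewrite fE (_ : (fun k => _) =
  fun k => \sum_j u_ k 0 j *: f (delta_mx 0 j)); last exact/funext.
apply: cvg_sum => j; apply: cvgZ; last exact: cvg_cst.
exact: cvg_coord.
Qed.

Lemma cvg_dot p (u_ v_ : T -> 'rV[R]_p) (u v : 'rV[R]_p) :
  u_ @ F --> u -> v_ @ F --> v -> (fun k => dot (u_ k) (v_ k)) @ F --> dot u v.
Proof.
move=> cu cv; rewrite dot_sum (_ : (fun k => _) =
  fun k => \sum_j u_ k 0 j * v_ k 0 j); last by apply/funext => k; exact: dot_sum.
by apply: cvg_sum => j; apply: cvg_mul; exact: cvg_coord.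
Qed.

Lemma cvg_enorm p (u_ : T -> 'rV[R]_p) (u : 'rV[R]_p) :
  u_ @ F --> u -> (fun k => enorm (u_ k)) @ F --> enorm u.
Proof.
move=> cu; rewrite /enorm.
by apply: (continuous_cvg _ (@sqrt_continuous R (dot u u))); exact: cvg_dot.
Qed.

Lemma cvg_dist0 (f : T -> R) (a : R) :
  f @ F --> a -> (fun k => `|f k - a|) @ F --> (0 : R).
Proof.
move=> cf; rewrite -(normr0 R) -(subrr a).
by apply: cvg_norm; apply: cvgB => //; exact: cvg_cst.
Qed.

Lemma cvg_enorm_dist0 p (u_ : T -> 'rV[R]_p) (u : 'rV[R]_p) :
  u_ @ F --> u -> (fun k => enorm (u_ k - u)) @ F --> (0 : R).
Proof.
move=> cu; rewrite -(@enorm0 R p) -(subrr u).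
by apply: cvg_enorm; apply: cvgB => //; exact: cvg_cst.
Qed.

Lemma cvg_lsub p q (u_ : T -> 'rV[R]_(p + q)) (u : 'rV[R]_(p + q)) :
  u_ @ F --> u -> (fun k => lsubmx (u_ k)) @ F --> lsubmx u.
Proof. exact: (cvg_linear (f := lsubmx : {linear 'rV[R]_(p + q) -> 'rV[R]_p})). Qed.

Lemma cvg_rsub p q (u_ : T -> 'rV[R]_(p + q)) (u : 'rV[R]_(p + q)) :
  u_ @ F --> u -> (fun k => rsubmx (u_ k)) @ F --> rsubmx u.
Proof. exact: (cvg_linear (f := rsubmx : {linear 'rV[R]_(p + q) -> 'rV[R]_q})). Qed.

Lemma cvg_row_mx p q (u_ : T -> 'rV[R]_p) (v_ : T -> 'rV[R]_q)
    (u : 'rV[R]_p) (v : 'rV[R]_q) :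
  u_ @ F --> u -> v_ @ F --> v ->
  (fun k => row_mx (u_ k) (v_ k)) @ F --> row_mx u v.
Proof.
move=> cu cv; have rE (a : 'rV[R]_p) (b : 'rV[R]_q) :
  row_mx a b = a *m row_mx 1%:M 0 + b *m row_mx 0 1%:M.
  by rewrite !mul_mx_row !mulmx0 !mulmx1 add_row_mx addr0 add0r.
rewrite rE; under eq_fun do rewrite rE.
by apply: cvg_add; [exact: (cvg_linear (f := mulmxr (row_mx 1%:M 0)))
  |exact: (cvg_linear (f := mulmxr (row_mx 0 1%:M)))].
Qed.

End Cvg.

Lemma continuous_linear_rV {R : realType} p {V : normedModType R}
  (f : {linear 'rV[R]_p -> V}) : continuous f.
Proof.
move=> u; have cu : id @ u --> u by exact: cvg_id.
exact: (cvg_linear (f := f) cu).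
Qed.

(** * Variational cones of a general set *)

Section VariationalCones.
Context {R : realType} {p : nat} (C : set 'rV[R]_p).
Implicit Types (z d v : 'rV[R]_p) (t : nat -> R).

Lemma down0_exists : exists t, down0 t.
Proof.
exists harmonic; split=> [k|]; first by rewrite harmonic_gt0.
exact: cvg_harmonic.
Qed.

Lemma cvg_step t (d_ : nat -> 'rV[R]_p) z d : down0 t -> d_ @ \oo --> d ->
  (fun k => z + t k *: d_ k) @ \oo --> z.
Proof.
move=> [_ t0] cd; rewrite -[X in _ --> X]addr0 -(scale0r d).
by apply: cvg_add; [exact: cvg_cst|exact: cvgZ].
Qed.

Lemma regular_normal_cone0 z : C z -> regular_normal_cone C z 0.
Proof.
move=> Cz; split=> // e e0; near=> z' => _.
by rewrite dot0l mulr_ge0 ?enorm_ge0// ltW.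
Unshelve. all: by end_near. Qed.

(** The little-o of the definition is supplied as an explicit factor [g] vanishing at [z]; explicit
    regular normals are verified in this form. *)
Lemma regular_normal_coneP z v (g : 'rV[R]_p -> R) : C z -> g @ z --> 0 ->
  (\forall z' \near z, C z' -> dot v (z' - z) <= g z' * enorm (z' - z)) ->
  regular_normal_cone C z v.
Proof.
move=> Cz g0 gP; split=> // e e0.
apply: filterS2 gP (cvgr_lt _ g0 e e0) => z' H /ltW ge Cz'.
by apply: le_trans (H Cz') _; rewrite ler_wpM2r ?enorm_ge0.
Qed.

(** Regular normals are polar to tangents: insert [z + t k *: d_ k] in the normal inequality, divide
    by [t k], and let [k] tend to infinity, then [e] to 0. Exhibiting tangents thus bounds the
    regular normals from above. *)
Lemma regular_normal_tangent z v d :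
  regular_normal_cone C z v -> tangent_cone C z d -> dot v d <= 0.
Proof.
move=> [Cz vP] [t [d_ [t0 cd dP]]].
have le_e e : 0 < e -> dot v d <= e * enorm d.
  move=> e0; rewrite -subr_ge0.
  apply: (@cvgr_to_ge _ \oo _ _ (fun k => e * enorm (d_ k) - dot v (d_ k))).
    apply: cvg_add; first by apply: cvg_mul; [exact: cvg_cst|exact: cvg_enorm].
    by apply: cvg_opp; apply: cvg_dot => //; exact: cvg_cst.
  have H := cvg_near (cvg_step (z := z) t0 cd) (vP _ e0).
  apply: filterS H => k /= /(_ (dP k)); have tk := t0.1 k.
  rewrite [z + _]addrC addrK enormZ dotE gtr0_norm// mulrCA.
  by rewrite subr_ge0 ler_pM2l.
apply/ler_addgt0Pl => e e0; rewrite addr0.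
have D0 : 0 < enorm d + 1 by rewrite ltr_wpDl ?enorm_ge0.
(* The summand 1 keeps the denominator positive when [d = 0]. *)
apply: le_trans (le_e (e / (enorm d + 1)) _) _; first by rewrite divr_gt0.
by rewrite mulrAC ler_pdivrMr// ler_pM2l// lerDl.
Qed.

Lemma dir_normal_cone_sub z d : dir_normal_cone C z d `<=` limiting_normal_cone C z.
Proof.
move=> v [t [d_ [v_ [t0 cd cv dP]]]].
exists (fun k => z + t k *: d_ k), v_; split => //; first exact: cvg_step cd.
by move=> k; have [] := dP k.
Qed.

Lemma inner_dir_normal_cone_sub z d :
  inner_dir_normal_cone C z d `<=` dir_normal_cone C z d.
Proof.
move=> v vP; have [t t0] := down0_exists.
by have [d_ [v_ [cd cv dP]]] := vP _ t0; exists t, d_, v_.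
Qed.

(** A squeeze: the lower bound is asked of the inner cone, which always lies in the directional
    one. *)
Lemma dir_normal_cone_eq (S : set 'rV[R]_p) z d :
  dir_normal_cone C z d `<=` S -> S `<=` inner_dir_normal_cone C z d ->
  dir_normal_cone C z d = S.
Proof.
move=> dS Sd; apply/seteqP; split=> // v /Sd; exact: inner_dir_normal_cone_sub.
Qed.

(** Since inner directional normals are limiting normals, a lower bound along a single direction [d]
    is enough. *)
Lemma limiting_normal_cone_eq (S : set 'rV[R]_p) z d :
  limiting_normal_cone C z `<=` S -> S `<=` inner_dir_normal_cone C z d ->
  limiting_normal_cone C z = S.
Proof.
move=> NS Sd; apply/seteqP; split=> // v /Sd/inner_dir_normal_cone_sub.
exact: dir_normal_cone_sub.
Qed.

Lemma dir_normal_cone_tangent z d v :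
  dir_normal_cone C z d v -> tangent_cone C z d.
Proof.
move=> [t [d_ [v_ [t0 cd cv dP]]]]; exists t, d_; split => // k.
by have [] := dP k.
Qed.

Lemma tangent_dir_normal_cone z d : tangent_cone C z d -> dir_normal_cone C z d 0.
Proof.
move=> [t [d_ [t0 cd dP]]]; exists t, d_, (fun=> 0); split => //.
  exact: cvg_cst.
by move=> k; exact: regular_normal_cone0.
Qed.

Lemma inner_tangent_coneP z d :
  inner_tangent_cone C z d <-> inner_dir_normal_cone C z d 0.
Proof.
split=> [dP t t0|dP t t0].
  have [d_ [cd Cd]] := dP _ t0; exists d_, (fun=> 0); split => //.
    exact: cvg_cst.
  by move=> k; exact: regular_normal_cone0.
have [d_ [v_ [cd cv vP]]] := dP _ t0; exists d_; split => // k.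
by have [] := vP k.
Qed.

Lemma directionally_regular_tangent z : C z -> directionally_regular C ->
  tangent_cone C z = inner_tangent_cone C z.
Proof.
move=> Cz reg; apply/seteqP; split=> d.
  by move=> /tangent_dir_normal_cone; rewrite reg// -inner_tangent_coneP.
by rewrite inner_tangent_coneP -reg//; exact: dir_normal_cone_tangent.
Qed.

(* For the finitely many remaining indices one stays at [z], where [0] is a
   regular normal. *)
Lemma inner_dir_normal_cone_near z d v : C z ->
  (forall t, down0 t -> exists d_ v_ : nat -> 'rV[R]_p,
    [/\ d_ @ \oo --> d, v_ @ \oo --> v
      & \forall k \near \oo, regular_normal_cone C (z + t k *: d_ k) (v_ k)]) ->
  inner_dir_normal_cone C z d v.
Proof.
move=> Cz vP t t0; have [d_ [v_ [cd cv dP]]] := vP _ t0.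
pose P k := `[< regular_normal_cone C (z + t k *: d_ k) (v_ k) >].
exists (fun k => if P k then d_ k else 0), (fun k => if P k then v_ k else 0).
split.
- apply: cvg_trans cd; apply: near_eq_cvg.
  by apply: filterS dP => k kP; rewrite /P asboolT.
- apply: cvg_trans cv; apply: near_eq_cvg.
  by apply: filterS dP => k kP; rewrite /P asboolT.
- move=> k; case: ifPn => [/asboolP //|_]; rewrite scaler0 addr0.
  exact: regular_normal_cone0.
Qed.

End VariationalCones.

(** * Transport of the variational cones by a linear isometric involution *)

Section Isometry.
Context {R : realType} {p : nat} (C : set 'rV[R]_p).
Variable J : {linear 'rV[R]_p -> 'rV[R]_p}.
Hypothesis JK : involutive J.
Hypothesis dotJ : forall u v, dot (J u) (J v) = dot u v.
Hypothesis CJ : forall z, C z -> C (J z).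
Implicit Types (z d v : 'rV[R]_p).

Let cvgJ (z_ : nat -> 'rV[R]_p) z :
  z_ @ \oo --> z -> (fun k => J (z_ k)) @ \oo --> J z.
Proof. exact: cvg_linear. Qed.

(** [J] is its own adjoint, and [J z' - z = J (z' - J z)], so the inequality at [z] evaluated at
    [J z'] is the one required at [J z]. *)
Lemma regular_normal_cone_isometry z v :
  regular_normal_cone C z v -> regular_normal_cone C (J z) (J v).
Proof.
move=> [Cz vP]; split=> [|e e0]; first exact: CJ.
have cJ : J @ J z --> z.
  by rewrite -[X in _ --> X]JK; exact: continuous_linear_rV.
have H0 := cvg_near cJ (vP _ e0); apply: filterS H0 => z' /= H Cz'.
have := H (CJ Cz').
have -> : J z' - z = J (z' - J z) by rewrite linearB JK.
by rewrite -[v in dot v _]JK dotJ /enorm dotJ.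
Qed.

Lemma tangent_cone_isometry z d :
  tangent_cone C z d -> tangent_cone C (J z) (J d).
Proof.
move=> [t [d_ [t0 cd dP]]]; exists t, (fun k => J (d_ k)); split => //.
  exact: cvgJ.
by move=> k; rewrite -linearZ -linearD; exact: CJ.
Qed.

Lemma limiting_normal_cone_isometry z v :
  limiting_normal_cone C z v -> limiting_normal_cone C (J z) (J v).
Proof.
move=> [z_ [v_ [cz cv Cz vP]]].
exists (fun k => J (z_ k)), (fun k => J (v_ k)); split; [exact: cvgJ..| |].
  by move=> k; exact: CJ.
by move=> k; exact: regular_normal_cone_isometry.
Qed.

Lemma dir_normal_cone_isometry z d v :
  dir_normal_cone C z d v -> dir_normal_cone C (J z) (J d) (J v).
Proof.
move=> [t [d_ [v_ [t0 cd cv dP]]]].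
exists t, (fun k => J (d_ k)), (fun k => J (v_ k)); split=> //; [exact: cvgJ..|].
by move=> k; rewrite -linearZ -linearD; exact: regular_normal_cone_isometry.
Qed.

Lemma inner_dir_normal_cone_isometry z d v :
  inner_dir_normal_cone C z d v -> inner_dir_normal_cone C (J z) (J d) (J v).
Proof.
move=> vP t t0; have [d_ [v_ [cd cv dP]]] := vP _ t0.
exists (fun k => J (d_ k)), (fun k => J (v_ k)); split=> //; [exact: cvgJ..|].
by move=> k; rewrite -linearZ -linearD; exact: regular_normal_cone_isometry.
Qed.

End Isometry.

(** * Directional normals of a cone at the origin *)

Section ConeAtOrigin.
Context {R : realType} {p : nat} (C : set 'rV[R]_p).
Hypothesis CZ : forall (a : R) z, 0 < a -> C z -> C (a *: z).
Implicit Types (z d v : 'rV[R]_p).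

(** Under [z' |-> a^-1 *: z'] both sides of the normal inequality are multiplied by the same
    positive factor. *)
Lemma regular_normal_coneZ (a : R) z v : 0 < a ->
  regular_normal_cone C z v -> regular_normal_cone C (a *: z) v.
Proof.
move=> a0 [Cz vP]; split=> [|e e0]; first exact: CZ.
have ai : 0 < a^-1 by rewrite invr_gt0.
have ca : (fun z' => a^-1 *: z') @ (a *: z) --> z.
  rewrite -[X in _ --> X](scalerK (lt0r_neq0 a0)).
  exact: (continuous_linear_rV (f := *:%R a^-1)).
have H0 := cvg_near ca (vP _ e0); apply: filterS H0 => z' /= H Cz'.
have := H (CZ ai Cz').
have -> : a^-1 *: z' - z = a^-1 *: (z' - a *: z).
  by rewrite scalerBr scalerA mulVf ?scale1r ?lt0r_neq0.
by rewrite enormZ dotZr gtr0_norm// mulrCA ler_pM2l.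
Qed.

(** Points [d_ k] tending to [d] serve as directions at 0 for every [t], because [t k *: d_ k] has
    all the regular normals of [d_ k]. *)
Lemma limiting_sub_inner_dir_normal_cone0 d :
  limiting_normal_cone C d `<=` inner_dir_normal_cone C 0 d.
Proof.
move=> v [d_ [v_ [cd cv Cd vP]]] t [t0 _]; exists d_, v_; split => // k.
by rewrite add0r; exact: regular_normal_coneZ.
Qed.

Lemma dir_sub_limiting_normal_cone0 d :
  dir_normal_cone C 0 d `<=` limiting_normal_cone C d.
Proof.
move=> v [t [d_ [v_ [[t0 _] cd cv vP]]]].
have rP k : regular_normal_cone C (d_ k) (v_ k).
  rewrite -[d_ k](scalerK (lt0r_neq0 (t0 k))).
  by apply: regular_normal_coneZ; rewrite ?invr_gt0// -[_ *: _]add0r.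
by exists d_, v_; split => // k; have [] := rP k.
Qed.

End ConeAtOrigin.

(** * The second-order cone and its complementarity set *)

Lemma dot_row_mx (R : realType) p q (a c : 'rV[R]_p) (b d : 'rV[R]_q) :
  dot (row_mx a b) (row_mx c d) = dot a c + dot b d.
Proof. by rewrite /dot tr_row_mx mul_row_col mxE. Qed.

(** The component of [u] orthogonal to [x] is itself an admissible test vector [d], hence orthogonal
    to itself. *)
Lemma line_dotP (R : realType) p (x u : 'rV[R]_p) : x != 0 ->
  (forall d, dot x d = 0 -> dot u d = 0) -> u = (dot u x / dot x x) *: x.
Proof.
move=> /dot_gt0 xx ux; apply/eqP; rewrite -subr_eq0; apply/eqP/dot_eq0.
set d := u - _; have xd : dot x d = 0.
  by rewrite /d !dotE (dotC x u) divfK ?subrr// lt0r_neq0.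
by rewrite {1}/d dotDl dotNl dotZl xd ux// mulr0 subr0.
Qed.

Section SecondOrderCone.
Context {R : realType} {n : nat}.
Notation V := 'rV[R]_n.+1.
Implicit Types (x y d w : V) (s t : R).

Definition e1 : V := delta_mx 0 0.

(** The first coordinate, written as an inner product so that [dotE] and [cvg_dot] apply to it. *)
Definition hd x : R := dot x e1.

(** The Lorentz form, the square of the first coordinate minus the squared norm of the rest. *)
Definition qf x : R := dot x (hat x).

Lemma hdE x : hd x = x 0 0.
Proof. by rewrite /hd /dot trmx_delta -colE mxE. Qed.

Lemma dot_e1 : dot e1 e1 = 1.
Proof. by rewrite -/(hd e1) hdE mxE. Qed.

(** [hat] is the reflection fixing the axis [e1]; this block-free form reduces identities about it
    to [dotE] and [ring]. *)
Lemma hatE x : hat x = (2 * hd x) *: e1 - x.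
Proof.
rewrite hdE; apply/rowP => j; rewrite /hat !mxE.
case: (@split_ordP 1 n j) => i ->; rewrite !mxE.
  have -> : lshift n i = 0 by apply/val_inj; rewrite ord1.
  by rewrite eqxx/=; ring.
by rewrite mulr0 add0r.
Qed.

Lemma hd_hat x : hd (hat x) = hd x.
Proof. rewrite hatE /hd !dotE dot_e1. ring. Qed.

Lemma hatK x : hat (hat x) = x.
Proof. by rewrite hatE hd_hat hatE subKr. Qed.

Lemma hatD x y : hat (x + y) = hat x + hat y.
Proof. by rewrite !hatE /hd !dotE mulrDr scalerDl opprD addrACA. Qed.

Lemma hatZ s x : hat (s *: x) = s *: hat x.
Proof. by rewrite !hatE /hd !dotE scalerBr scalerA mulrCA. Qed.

Lemma dot_hatC x y : dot (hat x) y = dot x (hat y).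
Proof. by rewrite !hatE !dotE /hd (dotC e1); ring. Qed.

Lemma dot_hat x y : dot (hat x) (hat y) = dot x y.
Proof. by rewrite dot_hatC hatK. Qed.

Lemma qfE x : qf x = 2 * hd x ^+ 2 - dot x x.
Proof. by rewrite /qf hatE !dotE /hd; ring. Qed.

Lemma qf_hat x : qf (hat x) = qf x.
Proof. by rewrite /qf hatK dotC. Qed.

Lemma qfD x y : qf (x + y) = qf x + 2 * dot (hat x) y + qf y.
Proof. by rewrite /qf hatD !dotE -(dot_hatC x y) (dotC y); ring. Qed.

Lemma qfZ s x : qf (s *: x) = s ^+ 2 * qf x.
Proof. by rewrite /qf hatZ !dotE; ring. Qed.

Lemma hd_sqr_le x : hd x ^+ 2 <= dot x x.
Proof. by rewrite (le_trans (dot_sqr_le _ _))// dot_e1 mulr1. Qed.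

Lemma normr_qf_le x : `|qf x| <= enorm x ^+ 2.
Proof.
rewrite qfE enorm_sqr ler_norml; have := hd_sqr_le x; have := sqr_ge0 (hd x).
by move=> ? ?; apply/andP; split; lra.
Qed.

Lemma hat0 : hat (0 : V) = 0.
Proof. by rewrite hatE /hd dot0l mulr0 scale0r subr0. Qed.

Lemma hat_eq0 x : (hat x == 0) = (x == 0).
Proof. by apply/eqP/eqP => [h|->]; [rewrite -(hatK x) h|]; rewrite hat0. Qed.

(** The second component has squared norm [hd x ^+ 2 - qf x], so on [hd x >= 0] the norm inequality
    is the sign condition on [qf x]. *)
Lemma socP x : soc x <-> 0 <= hd x /\ 0 <= qf x.
Proof.
rewrite /soc/= /enorm.
have hx : @lsubmx R 1 1 n x 0 0 = hd x.
  by rewrite mxE hdE; congr (x _ _); exact/val_inj.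
rewrite hx.
have -> : dot (@rsubmx R 1 1 n x) (@rsubmx R 1 1 n x) = hd x ^+ 2 - qf x.
  have := dot_row_mx (@lsubmx R 1 1 n x) (@lsubmx R 1 1 n x)
    (@rsubmx R 1 1 n x) (@rsubmx R 1 1 n x).
  rewrite !hsubmxK [dot (lsubmx _) _]dot_sum big_ord1 !hx => e.
  by rewrite qfE (e : dot x x = _); ring.
split=> [h|[h0 h1]].
  have h0 : 0 <= hd x by apply: le_trans h; exact: sqrtr_ge0.
  split=> //; rewrite leNgt; apply/negP => q0.
  have : hd x ^+ 2 < hd x ^+ 2 - qf x by rewrite ltrDl oppr_gt0.
  rewrite -(ltr_sqrt (hd x ^+ 2)) ?sqrtr_sqr ?ger0_norm //; first lra.
  have := sqr_ge0 (hd x); lra.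
rewrite -[leRHS]ger0_norm// -sqrtr_sqr ler_wsqrtr//; lra.
Qed.

Lemma socZ s x : 0 <= s -> soc x -> soc (s *: x).
Proof.
move=> s0 /socP[h q]; apply/socP; rewrite qfZ /hd dotE -/(hd x).
by rewrite !mulr_ge0// sqr_ge0.
Qed.

Lemma soc_hat x : soc x -> soc (hat x).
Proof. by move=> /socP xK; apply/socP; rewrite hd_hat qf_hat. Qed.

(* The vector on the left has [hd = 0], so its squared norm is [- qf] of it. *)
Lemma complementarity_gap x y :
  dot (hd x *: y - hd y *: hat x) (hd x *: y - hd y *: hat x) =
  2 * hd x * hd y * dot x y - hd x ^+ 2 * qf y - hd y ^+ 2 * qf x.
Proof.
by rewrite !qfE hatE /hd !dotE dot_e1 (dotC e1 x) (dotC e1 y) (dotC y x); ring.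
Qed.

Lemma soc_hd_eq0 x : soc x -> hd x = 0 -> x = 0.
Proof.
move=> /socP[_]; rewrite qfE => q h; apply: dot_eq0.
by have := dot_ge0 x; move: q; rewrite h; lra.
Qed.

(** By [complementarity_gap], [2 * hd x * hd y * dot x y] is a squared norm plus two nonnegative
    terms; if [hd x] or [hd y] vanishes, so does the vector. *)
Lemma soc_dot_ge0 x y : soc x -> soc y -> 0 <= dot x y.
Proof.
move=> xK yK; have [x0 qx] := (socP x).1 xK; have [y0 qy] := (socP y).1 yK.
move: (x0); rewrite le_eqVlt => /orP[/eqP/esym|x1].
  by move=> /(soc_hd_eq0 xK) ->; rewrite dot0l.
move: (y0); rewrite le_eqVlt => /orP[/eqP/esym|y1].
  by move=> /(soc_hd_eq0 yK) ->; rewrite dot0r.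
have := dot_ge0 (hd x *: y - hd y *: hat x); rewrite complementarity_gap => h.
have xy : 0 < 2 * hd x * hd y by rewrite !mulr_gt0.
rewrite -(pmulr_rge0 _ xy).
have := mulr_ge0 (sqr_ge0 (hd x)) qy; have := mulr_ge0 (sqr_ge0 (hd y)) qx; lra.
Qed.

(** With [dot x y = 0] the gap identity makes three nonnegative quantities sum to 0, so each of them
    is 0. *)
Lemma soc_compl_eq x y : soc x -> soc y -> dot x y = 0 ->
  hd x *: y = hd y *: hat x /\ hd y * qf x = 0.
Proof.
move=> /socP[x0 qx] /socP[y0 qy] xy.
have gap := complementarity_gap x y; rewrite xy in gap.
have xqy := mulr_ge0 (sqr_ge0 (hd x)) qy.
have yqx := mulr_ge0 (sqr_ge0 (hd y)) qx.
have ge0 := dot_ge0 (hd x *: y - hd y *: hat x).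
split; first by apply/eqP; rewrite -subr_eq0; apply/eqP/dot_eq0; lra.
have /eqP : hd y ^+ 2 * qf x = 0 by lra.
by rewrite mulf_eq0 sqrf_eq0 => /orP[]/eqP ->; rewrite ?mul0r ?mulr0.
Qed.

Lemma pairset_row_mx (P : V -> V -> Prop) x y : pairset P (row_mx x y) = P x y.
Proof. by rewrite /pairset/= row_mxKl row_mxKr. Qed.

Lemma soc_compl_scale x s : soc x -> 0 <= s -> s * qf x = 0 ->
  soc_compl (row_mx x (s *: hat x)).
Proof.
move=> xK s0 sq; rewrite /soc_compl pairset_row_mx; split=> //.
  by apply: socZ => //; exact: soc_hat.
by rewrite dotE.
Qed.

Lemma soc_compl_chart x y : 0 < hd x -> soc_compl (row_mx x y) ->
  [/\ 0 <= qf x, 0 <= hd y / hd x, hd y / hd x * qf x = 0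
    & y = (hd y / hd x) *: hat x].
Proof.
move=> x0; rewrite /soc_compl pairset_row_mx => -[xK yK xy].
have [h h'] := soc_compl_eq xK yK xy.
have [[_ ?] [? _]] := ((socP _).1 xK, (socP _).1 yK).
split=> //; first by rewrite divr_ge0// ltW.
  by rewrite mulrAC h' mul0r.
by rewrite mulrC -scalerA -h scalerK// lt0r_neq0.
Qed.

End SecondOrderCone.

(** * Regular normals in the chart [hd x > 0] *)

Section ConeCvg.
Context {R : realType} {n : nat} {T : Type} {F : set_system T} {FF : Filter F}.
Notation V := 'rV[R]_n.+1.

Lemma cvg_hd (x_ : T -> V) (x : V) : x_ @ F --> x -> (fun k => hd (x_ k)) @ F --> hd x.
Proof. by move=> cx; apply: cvg_dot => //; exact: cvg_cst. Qed.

Lemma cvg_hat (x_ : T -> V) (x : V) : x_ @ F --> x -> (fun k => hat (x_ k)) @ F --> hat x.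
Proof.
move=> cx; rewrite hatE; under eq_fun do rewrite hatE.
apply: cvg_add; last exact: cvg_opp.
apply: cvgZ; last exact: cvg_cst.
by apply: cvg_mul; [exact: cvg_cst|exact: cvg_hd].
Qed.

Lemma cvg_qf (x_ : T -> V) (x : V) : x_ @ F --> x -> (fun k => qf (x_ k)) @ F --> qf x.
Proof. by move=> cx; apply: cvg_dot => //; exact: cvg_hat. Qed.

(** [hat] preserves [hd], so the ratio of first coordinates is a continuous chart coordinate
    recovering [s] from [(x, s hat x)]. *)
Lemma cvg_slope (x_ y_ : T -> V) (x : V) (s : R) : 0 < hd x ->
  x_ @ F --> x -> y_ @ F --> s *: hat x ->
  (fun k => hd (y_ k) / hd (x_ k)) @ F --> s.
Proof.
move=> x0 cx cy; have -> : s = hd (s *: hat x) / hd x.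
  by rewrite {1}/hd dotZl -/(hd _) hd_hat mulfK// lt0r_neq0.
apply: cvg_mul; first exact: cvg_hd.
by apply: cvgV; [rewrite lt0r_neq0|exact: cvg_hd].
Qed.

End ConeCvg.

Section Chart.
Context {R : realType} {n : nat}.
Notation V := 'rV[R]_n.+1.
Notation Omega := (@soc_compl R n).
Implicit Types (x y d w u v : V) (s r c a : R) (t : nat -> R).

Lemma hd_gt0_hat_neq0 x : 0 < hd x -> hat x != 0.
Proof.
by rewrite hat_eq0; apply: contraTneq => ->; rewrite /hd dot0l ltxx.
Qed.

(* [x' |-> x' - qf x' / (2 <x', x>) hat x] retracts a neighbourhood of [x] onto
   the boundary of the cone, because [qf (hat x) = 0] and
   [<hat x', hat x> = <x', x>]. *)
Lemma bd_path x d t : 0 < hd x -> qf x = 0 -> dot d (hat x) = 0 -> down0 t ->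
  exists d_ : nat -> V, d_ @ \oo --> d /\
    \forall k \near \oo, qf (x + t k *: d_ k) = 0.
Proof.
move=> x0 qx dx t0.
have xx : 0 < dot x x by apply: dot_gt0; rewrite -hat_eq0 hd_gt0_hat_neq0.
pose e k := dot (x + t k *: d) x.
have ce : e @ \oo --> dot x x.
  by apply: cvg_dot; [apply: cvg_step => //; exact: cvg_cst|exact: cvg_cst].
have c2e : (fun k => 2 * e k) @ \oo --> 2 * dot x x.
  by apply: cvg_mul; [exact: cvg_cst|exact: ce].
(* Here [qf (x + t k *: d) = t k ^+ 2 * qf d], so this is the correction of the retraction divided
   by [t k]. *)
exists (fun k => d - (t k * qf d / (2 * e k)) *: hat x); split.
  rewrite -[X in _ --> X]subr0 -(scale0r (hat x)).
  apply: cvg_add; first exact: cvg_cst.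
  apply: cvg_opp; apply: cvgZ; last exact: cvg_cst.
  rewrite -(mul0r (2 * dot x x)^-1) -(mul0r (qf d)).
  apply: cvg_mul.
    by apply: cvg_mul; [exact: t0.2|exact: cvg_cst].
  by apply: cvgV c2e; rewrite mulf_neq0// lt0r_neq0.
have near_gt0 : \forall k \near \oo, 0 < e k by exact: (cvgr_gt _ ce).
apply: filterS near_gt0 => k ek.
rewrite scalerBr addrA scalerA -scaleNr qfD qfZ qf_hat qx dotZr dot_hat -/(e k).
rewrite qfD qfZ qx dotZr (dotC _ d) dx.
by field; rewrite lt0r_neq0.
Qed.

Lemma soc_near x d t (d_ : nat -> V) : 0 < hd x -> down0 t -> d_ @ \oo --> d ->
  \forall k \near \oo, 0 < hd (x + t k *: d_ k).
Proof.
by move=> x0 t0 cd; apply: (cvgr_gt _ (cvg_hd (cvg_step (z := x) t0 cd))).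
Qed.

(** A path in the stratum [qf = 0 < s], whose direction is the derivative of
    [(x, s) |-> (x, s hat x)] along [(d, r)]. *)
Lemma compl_path x s d r t : 0 < hd x -> qf x = 0 -> dot d (hat x) = 0 ->
  0 <= s -> 0 < s \/ 0 <= r -> down0 t ->
  exists (d_ w_ : nat -> V) (s_ : nat -> R),
  [/\ d_ @ \oo --> d, w_ @ \oo --> s *: hat d + r *: hat x, s_ @ \oo --> s,
      forall k, s *: hat x + t k *: w_ k = s_ k *: hat (x + t k *: d_ k)
    & \forall k \near \oo, [/\ 0 < hd (x + t k *: d_ k),
        qf (x + t k *: d_ k) = 0 & 0 < s_ k]].
Proof.
move=> x0 qx dx s0 sr t0; have [d_ [cd qd]] := bd_path x0 qx dx t0.
(* The extra [t k] leaves the limit direction unchanged and makes the coefficient positive even when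
   [s = r = 0]. *)
have cs : (fun k => s + t k * (r + t k)) @ \oo --> s.
  rewrite -[X in _ --> X]addr0 -(mul0r (r + 0)); apply: cvg_add; first exact: cvg_cst.
  apply: cvg_mul; first exact: t0.2.
  by apply: cvg_add; [exact: cvg_cst|exact: t0.2].
exists d_, (fun k => s *: hat (d_ k) + (r + t k) *: hat (x + t k *: d_ k)),
  (fun k => s + t k * (r + t k)); split => //.
- apply: cvg_add; first by apply: cvgZ; [exact: cvg_cst|exact: cvg_hat].
  apply: cvgZ; last by apply: cvg_hat; exact: cvg_step cd.
  by rewrite -[X in _ --> X]addr0; apply: cvg_add; [exact: cvg_cst|exact: t0.2].
- move=> k /=; set h := hat (_ + _).
  have hE : s *: h = s *: hat x + t k *: (s *: hat (d_ k)).
    by rewrite /h hatD hatZ scalerDr !scalerA mulrC.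
  by rewrite [RHS]scalerDl hE scalerDr [t k *: (_ *: h)]scalerA addrA.
have s_gt0 : \forall k \near \oo, 0 < s + t k * (r + t k).
  case: sr => [sgt0|r0]; first exact: (cvgr_gt _ cs).
  near=> k; have tk := t0.1 k.
  by rewrite ltr_wpDl// mulr_gt0// ltr_wpDl.
have h := soc_near x0 t0 cd.
by move: h qd s_gt0; apply: filterS3.
Unshelve. all: by end_near. Qed.

(** The annihilator of the tangent space, which consists of the [(d, s hat d + r hat x)] with
    [<d, hat x> = 0] and [r] real. At [s = 0] it describes limits of such normals at a corner. *)
Definition smooth_normal x s u v := dot v (hat x) = 0 /\ exists c, u = c *: hat x - s *: hat v.

(** The polar of the two tangent pieces at [(x, 0)]: the [(d, 0)] with [<d, hat x> >= 0], and the
    [(d, r hat x)] with [<d, hat x> = 0] and [r >= 0]. *)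
Definition corner_normal x u v := dot v (hat x) <= 0 /\ exists2 a, 0 <= a & u = - (a *: hat x).

Lemma soc_compl_near x y : 0 < hd x ->
  \forall z \near row_mx x y, Omega z ->
    [/\ 0 < hd (lsubmx z), 0 <= qf (lsubmx z), 0 <= hd (rsubmx z) / hd (lsubmx z),
      hd (rsubmx z) / hd (lsubmx z) * qf (lsubmx z) = 0 &
      rsubmx z = (hd (rsubmx z) / hd (lsubmx z)) *: hat (lsubmx z)].
Proof.
move=> x0; have cl : lsubmx @ row_mx x y --> x.
  by rewrite -[X in _ --> X](row_mxKl x y); exact: continuous_linear_rV.
have cx : (fun z => hd (lsubmx z)) @ row_mx x y --> hd x by exact: (cvg_hd cl).
have near_gt0 : \forall z \near row_mx x y, 0 < hd (lsubmx z).
  exact: (cvgr_gt _ cx).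
apply: filterS near_gt0 => z z0.
by rewrite -{1}[z]hsubmxK => /(soc_compl_chart z0)[].
Qed.

Lemma enorm_lsub p q (z : 'rV[R]_(p + q)) : enorm (lsubmx z) <= enorm z.
Proof.
have := dot_row_mx (lsubmx z) (lsubmx z) (rsubmx z) (rsubmx z).
by rewrite hsubmxK => h; rewrite ler_wsqrtr// h lerDl dot_ge0.
Qed.

Lemma dot_pair x y u v (z : 'rV[R]_(n.+1 + n.+1)) :
  dot (row_mx u v) (z - row_mx x y) = dot u (lsubmx z - x) + dot v (rsubmx z - y).
Proof.
by rewrite -{1}(hsubmxK z) opp_row_mx add_row_mx dot_row_mx.
Qed.

Lemma cvg_slope_nbhs x s : 0 < hd x ->
  (fun z => hd (rsubmx z) / hd (lsubmx z)) @ row_mx x (s *: hat x) --> s.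
Proof.
move=> x0; set z := row_mx x _.
have cl : lsubmx @ z --> x.
  by rewrite -[X in _ --> X](row_mxKl x (s *: hat x)); exact: continuous_linear_rV.
have cr : rsubmx @ z --> s *: hat x.
  by rewrite -[X in _ --> X](row_mxKr x (s *: hat x)); exact: continuous_linear_rV.
exact: (cvg_slope x0 cl cr).
Qed.

Lemma cvg_enorm_nbhs p (z : 'rV[R]_p) : (fun z' => enorm (z' - z)) @ z --> (0 : R).
Proof.
have cz : id @ z --> z by exact: cvg_id.
exact: (cvg_enorm_dist0 cz).
Qed.

(** Near this point [qf > 0] forces the second component of points of [Omega] to be 0, so the
    pairing with [(0, v)] vanishes identically. *)
Lemma regular_normal_int x v : 0 < hd x -> 0 < qf x ->
  regular_normal_cone Omega (row_mx x 0) (row_mx 0 v).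
Proof.
move=> x0 qx; apply: (@regular_normal_coneP _ _ _ _ _ (fun=> 0)).
- rewrite -(scale0r (hat x)); apply: soc_compl_scale; rewrite ?mul0r//.
  by apply/socP; split; exact: ltW.
- exact: cst_continuous.
have cl : lsubmx @ row_mx x (0 : V) --> x.
  by rewrite -[X in _ --> X](row_mxKl x (0 : V)); exact: continuous_linear_rV.
have q_gt0 : \forall z \near row_mx x (0 : V), 0 < qf (lsubmx z).
  exact: (cvgr_gt _ (cvg_qf cl)).
apply: filterS2 (soc_compl_near 0 x0) q_gt0 => z zO qz Oz.
have [_ _ _ sq yE] := zO Oz.
have /eqP s0 : hd (rsubmx z) / hd (lsubmx z) == 0.
  by move/eqP: sq; rewrite mulf_eq0 (gt_eqF qz) orbF.
by rewrite dot_pair yE s0 scale0r subrr dot0l dot0r mul0r addr0.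
Qed.

(** A nearby point of [Omega] is [(x + h, s' hat (x + h))] with [qf (x + h) = 0], that is,
    [<hat x, h> = - qf h / 2]. The pairing becomes [- c / 2 * qf h + (s' - s) <hat v, h>], and both
    terms are of second order. *)
Lemma regular_normal_smooth x s u v : 0 < hd x -> qf x = 0 -> 0 < s ->
  smooth_normal x s u v -> regular_normal_cone Omega (row_mx x (s *: hat x)) (row_mx u v).
Proof.
move=> x0 qx s0 [vx [c ->]]; set z := row_mx x _.
(* The two summands bound the two terms of the pairing, after division by the distance to [z]. *)
apply: (@regular_normal_coneP _ _ _ _ _ (fun z' => `|c| / 2 * enorm (z' - z) +
  `|hd (rsubmx z') / hd (lsubmx z') - s| * enorm (hat v))).
- apply: soc_compl_scale; rewrite ?qx ?mulr0 ?ltW//.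
  by apply/socP; rewrite qx lexx ltW.
- have c1 : (fun z' => `|c| / 2 * enorm (z' - z)) @ z --> (`|c| / 2) * 0.
    exact: (cvg_mul (cvg_cst _) (@cvg_enorm_nbhs _ z)).
  have c2 : (fun z' => `|hd (rsubmx z') / hd (lsubmx z') - s|) @ z --> (0 : R).
    exact: (cvg_dist0 (@cvg_slope_nbhs x s x0)).
  have c3 : (fun z' => `|hd (rsubmx z') / hd (lsubmx z') - s| * enorm (hat v)) @ z
      --> 0 * enorm (hat v) by exact: (cvg_mul c2 (cvg_cst _)).
  rewrite [X in _ --> X](_ : 0 = `|c| / 2 * 0 + 0 * enorm (hat v)); last by ring.
  exact: (cvg_add c1 c3).
have s_gt0 : \forall z' \near z, 0 < hd (rsubmx z') / hd (lsubmx z').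
  by apply: (cvgr_gt _ (cvg_slope_nbhs x0)).
apply: filterS2 (soc_compl_near (s *: hat x) x0) s_gt0 => z' zO s'_gt0 Oz.
have [_ _ _ sq] := zO Oz.
rewrite dot_pair; set s' := _ / _ in s'_gt0 sq *; move=> ->.
have qx' : qf (lsubmx z') = 0.
  by move/eqP: sq; rewrite mulf_eq0 (gt_eqF s'_gt0) => /eqP.
have hz : enorm (lsubmx z' - x) <= enorm (z' - z).
  by rewrite -{1}(row_mxKl x (s *: hat x)) -linearB enorm_lsub.
set h := lsubmx z' - x in hz *; have x'E : lsubmx z' = x + h by rewrite addrC subrK.
clearbody h.
have xh : dot (hat x) h = - (qf h / 2).
  by move: qx'; rewrite x'E qfD qx => e; lra.
rewrite x'E hatD !dotE !vx xh -(dot_hatC v h).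
have -> : c * - (qf h / 2) - s * dot (hat v) h +
  (s' * (0 + dot (hat v) h) - s * 0) = - c / 2 * qf h + (s' - s) * dot (hat v) h.
  by ring.
rewrite [leRHS]mulrDl; apply: lerD.
  apply: le_trans (ler_norm _) _; rewrite normrM normf_div normrN [`|2|]ger0_norm//.
  rewrite -[leRHS]mulrA ler_wpM2l ?divr_ge0// (le_trans (normr_qf_le h))// expr2.
  by rewrite ler_pM ?enorm_ge0.
apply: le_trans (ler_norm _) _; rewrite normrM -[leRHS]mulrA ler_wpM2l//.
by rewrite (le_trans (normr_dot_le _ _))// ler_wpM2l ?enorm_ge0.
Qed.

(** The pairing is [- a <hat x, h> + s' <v, hat x> + s' <hat v, h>]. The first term is nonpositive
    by self-polarity of the cone and [qf x = 0], the second by the sign of [<v, hat x>]; the third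
    is little-o since [s'] tends to 0. *)
Lemma regular_normal_corner x u v : 0 < hd x -> qf x = 0 ->
  corner_normal x u v -> regular_normal_cone Omega (row_mx x 0) (row_mx u v).
Proof.
move=> x0 qx [vx [a a0 ->]]; rewrite -(scale0r (hat x)); set z := row_mx x _.
have xK : soc x by apply/socP; rewrite qx lexx ltW.
apply: (@regular_normal_coneP _ _ _ _ _ (fun z' =>
  `|hd (rsubmx z') / hd (lsubmx z') - 0| * enorm (hat v))).
- by apply: soc_compl_scale; rewrite ?qx ?mulr0.
- have c2 : (fun z' => `|hd (rsubmx z') / hd (lsubmx z') - 0|) @ z --> (0 : R).
    exact: (cvg_dist0 (@cvg_slope_nbhs x 0 x0)).
  rewrite -[X in _ --> X](mul0r (enorm (hat v))).
  exact: (cvg_mul c2 (cvg_cst _)).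
apply: filterS (soc_compl_near (0 *: hat x) x0) => z' zO Oz.
have [x'0 qx' s0 sq] := zO Oz.
rewrite dot_pair; set s' := _ / _ in s0 sq *; move=> ->.
have x'K : soc (lsubmx z') by apply/socP; split=> //; exact: ltW.
have xx' : 0 <= dot (hat x) (lsubmx z') by apply: soc_dot_ge0 => //; exact: soc_hat.
have hz : enorm (lsubmx z' - x) <= enorm (z' - z).
  by rewrite -{1}(row_mxKl x (0 *: hat x)) -linearB enorm_lsub.
set h := lsubmx z' - x in hz *; have x'E : lsubmx z' = x + h by rewrite addrC subrK.
clearbody h.
have xh : 0 <= dot (hat x) h.
  by move: xx'; rewrite x'E dotDr (dotC (hat x)) -/(qf x) qx add0r.
rewrite x'E hatD scale0r subr0 !dotE -(dot_hatC v h).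
rewrite subr0; apply: (@le_trans _ _ (s' * dot (hat v) h)).
  by have := mulr_ge0 a0 xh; have := mulr_ge0_le0 s0 vx; lra.
apply: le_trans (ler_norm _) _; rewrite normrM -[leRHS]mulrA ler_wpM2l//.
by rewrite (le_trans (normr_dot_le _ _))// ler_wpM2l ?enorm_ge0.
Qed.

End Chart.

(** * Closedness of the normality conditions, along an arbitrary proper filter so that subsequences
    are covered *)

Section LimitNormals.
Context {R : realType} {n : nat} {T : Type} {F : set_system T} {FF : ProperFilter F}.
Notation V := 'rV[R]_n.+1.

Lemma cvg_near_unique {W : normedModType R} (f g : T -> W) (a b : W) :
  f @ F --> a -> g @ F --> b -> (\forall k \near F, f k = g k) -> a = b.
Proof.
move=> ca cb fg; apply/eqP; rewrite -subr_eq0; apply/eqP.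
have c0 : (fun k => f k - g k) @ F --> a - b by apply: cvgB.
apply: (cvg_unique (@norm_hausdorff _ W) c0).
apply: cvg_trans (@cvg_cst _ (0 : W) _ F _); apply: near_eq_cvg.
by apply: filterS fg => k ->; rewrite subrr.
Qed.

(** Membership in a line becomes an equation with the explicit projection coefficient, which passes
    to the limit. *)
Lemma line_coefE (x u : V) c : u = c *: x -> u = (dot u x / dot x x) *: x.
Proof.
move=> ->; have [->|x0] := eqVneq x 0; first by rewrite !scaler0.
by rewrite dotZl mulfK// lt0r_neq0// dot_gt0.
Qed.

Variables (x_ u_ v_ : T -> V) (s_ : T -> R) (x u v : V) (s : R).
Hypotheses (x0 : 0 < hd x) (cx : x_ @ F --> x) (cs : s_ @ F --> s).
Hypotheses (cu : u_ @ F --> u) (cv : v_ @ F --> v).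

Lemma cvg_line_coef (w_ : T -> V) (w : V) : w_ @ F --> w ->
  (fun k => (dot (w_ k) (hat (x_ k)) / dot (hat (x_ k)) (hat (x_ k))) *: hat (x_ k))
    @ F --> (dot w (hat x) / dot (hat x) (hat x)) *: hat x.
Proof.
move=> cw; have chx : (fun k => hat (x_ k)) @ F --> hat x by exact: cvg_hat.
apply: cvgZ => //; apply: cvg_mul; first exact: cvg_dot.
apply: cvgV; first by rewrite lt0r_neq0// dot_gt0// hd_gt0_hat_neq0.
exact: cvg_dot.
Qed.

Lemma limit_smooth : (\forall k \near F, smooth_normal (x_ k) (s_ k) (u_ k) (v_ k)) ->
  smooth_normal x s u v.
Proof.
move=> H; split.
  apply: (@cvg_near_unique R^o (fun k => dot (v_ k) (hat (x_ k))) (fun=> 0)).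
  - by apply: cvg_dot => //; exact: cvg_hat.
  - exact: cvg_cst.
  - by apply: filterS H => k [].
have cw : (fun k => u_ k + s_ k *: hat (v_ k)) @ F --> u + s *: hat v.
  by apply: cvg_add => //; apply: cvgZ => //; exact: cvg_hat.
exists (dot (u + s *: hat v) (hat x) / dot (hat x) (hat x)).
rewrite -[LHS](addrK (s *: hat v)); congr (_ - _).
apply: (cvg_near_unique cw (cvg_line_coef cw)).
by apply: filterS H => k [_ [c ->]]; rewrite subrK; exact: line_coefE (erefl _).
Qed.

Lemma limit_corner : (\forall k \near F, corner_normal (x_ k) (u_ k) (v_ k)) ->
  corner_normal x u v.
Proof.
move=> H; split.
  apply: (@cvgr_to_le _ F _ _ (fun k => dot (v_ k) (hat (x_ k)))).
    by apply: cvg_dot => //; exact: cvg_hat.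
  by apply: filterS H => k [].
exists (- (dot u (hat x) / dot (hat x) (hat x))).
  rewrite oppr_ge0 mulr_le0_ge0 ?invr_ge0 ?dot_ge0//.
  apply: (@cvgr_to_le _ F _ _ (fun k => dot (u_ k) (hat (x_ k)))).
    by apply: cvg_dot => //; exact: cvg_hat.
  apply: filterS H => k [_ [a a0 ->]].
  by rewrite dotNl dotZl oppr_le0 mulr_ge0// dot_ge0.
rewrite scaleNr opprK; apply: (cvg_near_unique cu (cvg_line_coef cu)).
by apply: filterS H => k [_ [a _ ->]]; rewrite -scaleNr; exact: line_coefE (erefl _).
Qed.

End LimitNormals.

(** * Inner directional normals along paths, and upper bounds for regular normals *)

Section ChartNormals.
Context {R : realType} {n : nat}.
Notation V := 'rV[R]_n.+1.
Notation Omega := (@soc_compl R n).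
Implicit Types (x y d w u v : V) (s r c a : R) (t : nat -> R).

Lemma step_row_mx x y d w (a : R) :
  row_mx x y + a *: row_mx d w = row_mx (x + a *: d) (y + a *: w).
Proof. by rewrite scale_row_mx add_row_mx. Qed.

Lemma soc_compl_chart_mem x s : 0 < hd x -> 0 <= qf x -> 0 <= s -> s * qf x = 0 ->
  Omega (row_mx x (s *: hat x)).
Proof.
by move=> x0 qx s0 sq; apply: soc_compl_scale => //; apply/socP; rewrite ltW.
Qed.

(* Subtracting [((b k - b0) / |hat x_k|^2) hat x_k], where
   [b k = <v, hat x_k>], makes [<v_k, hat x_k>] constant. *)
Lemma adjust_normal (x_ : nat -> V) x v : 0 < hd x -> x_ @ \oo --> x ->
  exists v_ : nat -> V, v_ @ \oo --> v /\
    \forall k \near \oo, dot (v_ k) (hat (x_ k)) = dot v (hat x).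
Proof.
move=> x0 cx.
have chx : (fun k => hat (x_ k)) @ \oo --> hat x by exact: cvg_hat.
have xx : 0 < dot (hat x) (hat x) by rewrite dot_gt0// hd_gt0_hat_neq0.
have cb : (fun k => dot v (hat (x_ k))) @ \oo --> dot v (hat x).
  by apply: cvg_dot => //; exact: cvg_cst.
have cxx : (fun k => dot (hat (x_ k)) (hat (x_ k))) @ \oo --> dot (hat x) (hat x).
  exact: cvg_dot.
exists (fun k => v - ((dot v (hat (x_ k)) - dot v (hat x))
  / dot (hat (x_ k)) (hat (x_ k))) *: hat (x_ k)); split.
  rewrite -[X in _ --> X]subr0 -(scale0r (hat x)).
  rewrite -(mul0r (dot (hat x) (hat x))^-1) -(subrr (dot v (hat x))).
  apply: cvgB; first exact: cvg_cst.
  apply: cvgZ => //; apply: cvg_mul; first by apply: cvgB => //; exact: cvg_cst.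
  by apply: cvgV => //; rewrite lt0r_neq0.
have xk0 : \forall k \near \oo, 0 < dot (hat (x_ k)) (hat (x_ k)).
  exact: (cvgr_gt _ cxx).
by apply: filterS xk0 => k xk; rewrite !dotE divfK ?lt0r_neq0//; ring.
Qed.

(** Along [compl_path] the vectors [v_ k] of [adjust_normal] stay orthogonal to [hat x_k], and the
    first components are rebuilt with the same [c]. The case [s = 0] reaches a corner from the
    smooth stratum. *)
Lemma inner_normal_smooth x s d r u v : 0 < hd x -> qf x = 0 -> dot d (hat x) = 0 ->
  0 <= s -> 0 < s \/ 0 <= r -> smooth_normal x s u v ->
  inner_dir_normal_cone Omega (row_mx x (s *: hat x))
    (row_mx d (s *: hat d + r *: hat x)) (row_mx u v).
Proof.
move=> x0 qx dx s0 sr [vx [c ->]].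
apply: inner_dir_normal_cone_near => [|t t0].
  by apply: soc_compl_chart_mem; rewrite ?qx ?mulr0.
have [d_ [w_ [s_ [cd cw cs yE near_bd]]]] := compl_path x0 qx dx s0 sr t0.
have cx : (fun k => x + t k *: d_ k) @ \oo --> x by exact: cvg_step cd.
have [v_ [cv vE]] := adjust_normal v x0 cx.
exists (fun k => row_mx (d_ k) (w_ k)),
  (fun k => row_mx (c *: hat (x + t k *: d_ k) - s_ k *: hat (v_ k)) (v_ k)).
split; [exact: cvg_row_mx| |].
  apply: cvg_row_mx => //; apply: cvgB.
    by apply: cvgZ; [exact: cvg_cst|exact: cvg_hat].
  by apply: cvgZ => //; exact: cvg_hat.
apply: filterS2 near_bd vE => k [xk0 qk sk] vk; rewrite step_row_mx yE.
by apply: regular_normal_smooth => //; split; [rewrite vk|exists c].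
Qed.

(** The path of [bd_path] with second component 0 consists of corners; [adjust_normal] preserves the
    sign of [<v, hat x>] along it. *)
Lemma inner_normal_corner x d u v : 0 < hd x -> qf x = 0 -> dot d (hat x) = 0 ->
  corner_normal x u v ->
  inner_dir_normal_cone Omega (row_mx x 0) (row_mx d 0) (row_mx u v).
Proof.
move=> x0 qx dx [vx [a a0 ->]].
apply: inner_dir_normal_cone_near => [|t t0].
  by rewrite -(scale0r (hat x)); apply: soc_compl_chart_mem; rewrite ?qx ?mulr0.
have [d_ [cd near_bd]] := bd_path x0 qx dx t0.
have cx : (fun k => x + t k *: d_ k) @ \oo --> x by exact: cvg_step cd.
have [v_ [cv vE]] := adjust_normal v x0 cx.
exists (fun k => row_mx (d_ k) 0),
  (fun k => row_mx (- (a *: hat (x + t k *: d_ k))) (v_ k)).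
split; [by apply: cvg_row_mx => //; exact: cvg_cst| |].
  apply: cvg_row_mx => //; apply: cvg_opp.
  by apply: cvgZ; [exact: cvg_cst|exact: cvg_hat].
apply: filterS3 (soc_near x0 t0 cd) near_bd vE => k xk0 qk vk.
rewrite step_row_mx scaler0 addr0.
by apply: regular_normal_corner => //; split; [rewrite vk|exists a].
Qed.

(** If [qf x > 0] or [<d, hat x> > 0], the straight path works; otherwise a boundary path is pushed
    inwards. *)
Lemma interior_path x d t : 0 < hd x -> 0 < qf x \/ qf x = 0 /\ 0 <= dot d (hat x) ->
  down0 t -> exists d_ : nat -> V, d_ @ \oo --> d /\
    \forall k \near \oo, 0 < qf (x + t k *: d_ k).
Proof.
move=> x0 H t0; have cst : (fun=> d) @ \oo --> d by exact: cvg_cst.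
case: H => [qx|[qx]].
  exists (fun=> d); split=> //.
  have cq : (fun k => qf (x + t k *: d)) @ \oo --> qf x.
    exact: cvg_qf (cvg_step t0 cst).
  exact: (cvgr_gt _ cq).
rewrite le_eqVlt => /orP[/eqP/esym dx|dx]; last first.
  exists (fun=> d); split=> //.
  have cq : (fun k => 2 * dot d (hat x) + t k * qf d) @ \oo --> 2 * dot d (hat x).
    rewrite -[X in _ --> X]addr0 -(mul0r (qf d)); apply: cvg_add; first exact: cvg_cst.
    by apply: cvg_mul; [exact: t0.2|exact: cvg_cst].
  have q_gt0 : \forall k \near \oo, 0 < 2 * dot d (hat x) + t k * qf d.
    by apply: (cvgr_gt _ cq); rewrite mulr_gt0.
  apply: filterS q_gt0 => k qk.
  have := mulr_gt0 (t0.1 k) qk; rewrite qfD qfZ qx dotZr (dotC (hat x)).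
  by congr (_ < _); ring.
have [d_ [cd near_bd]] := bd_path x0 qx dx t0.
(* With [x_k = x + t k *: d_ k] on the boundary, adding [t k ^+ 2 *: hat x] raises [qf] by
   [2 * t k ^+ 2 * dot x_k x]. *)
exists (fun k => d_ k + t k *: hat x); split.
  rewrite -[X in _ --> X]addr0 -(scale0r (hat x)); apply: cvg_add => //.
  by apply: cvgZ; [exact: t0.2|exact: cvg_cst].
have xx : 0 < dot x x by rewrite dot_gt0// -hat_eq0 hd_gt0_hat_neq0.
have cxx : (fun k => dot (x + t k *: d_ k) x) @ \oo --> dot x x.
  by apply: cvg_dot; [exact: cvg_step cd|exact: cvg_cst].
have xx_gt0 : \forall k \near \oo, 0 < dot (x + t k *: d_ k) x.
  exact: (cvgr_gt _ cxx).
apply: filterS2 near_bd xx_gt0 => k qk xk; have tk := t0.1 k.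
rewrite scalerDr addrA scalerA qfD qk qfZ qf_hat qx dotZr dot_hat mulr0 addr0 add0r.
by rewrite !mulr_gt0.
Qed.

Lemma inner_normal_int x d v : 0 < hd x -> 0 < qf x \/ qf x = 0 /\ 0 <= dot d (hat x) ->
  inner_dir_normal_cone Omega (row_mx x 0) (row_mx d 0) (row_mx 0 v).
Proof.
move=> x0 H; apply: inner_dir_normal_cone_near => [|t t0].
  rewrite -(scale0r (hat x)); apply: soc_compl_chart_mem; rewrite ?mul0r//.
  by case: H => [/ltW//|[-> _]].
have [d_ [cd q_gt0]] := interior_path x0 H t0.
exists (fun k => row_mx (d_ k) 0), (fun=> row_mx 0 v); split.
- by apply: cvg_row_mx => //; exact: cvg_cst.
- exact: cvg_cst.
apply: filterS2 (soc_near x0 t0 cd) q_gt0 => k xk0 qk.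
by rewrite step_row_mx scaler0 addr0; exact: regular_normal_int.
Qed.

Lemma tangent_interior x d : 0 < hd x -> 0 < qf x \/ qf x = 0 /\ 0 <= dot d (hat x) ->
  tangent_cone Omega (row_mx x 0) (row_mx d 0).
Proof.
move=> x0 H; have := inner_normal_int 0 x0 H.
by move/inner_dir_normal_cone_sub/dir_normal_cone_tangent.
Qed.

Lemma tangent_boundary x s d r : 0 < hd x -> qf x = 0 -> dot d (hat x) = 0 ->
  0 <= s -> 0 < s \/ 0 <= r ->
  tangent_cone Omega (row_mx x (s *: hat x)) (row_mx d (s *: hat d + r *: hat x)).
Proof.
move=> x0 qx dx s0 sr.
have N0 : smooth_normal x s 0 0.
  by split; [rewrite dot0l|exists 0; rewrite hat0 scale0r scaler0 subr0].
have := inner_normal_smooth x0 qx dx s0 sr N0.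
by move/inner_dir_normal_cone_sub/dir_normal_cone_tangent.
Qed.

(** Every [(d, 0)] is tangent here; test with [d = u]. *)
Lemma regular_normal_int_inv x u v : 0 < hd x -> 0 < qf x ->
  regular_normal_cone Omega (row_mx x 0) (row_mx u v) -> u = 0.
Proof.
move=> x0 qx /regular_normal_tangent H; apply: dot_eq0; apply/eqP.
rewrite eq_le dot_ge0 andbT.
by have := H _ (tangent_interior (d := u) x0 (or_introl qx)); rewrite dot_row_mx dot0r addr0.
Qed.

Lemma regular_normal_bd x s u v d r : 0 < hd x -> qf x = 0 -> 0 <= s ->
  regular_normal_cone Omega (row_mx x (s *: hat x)) (row_mx u v) ->
  dot d (hat x) = 0 -> 0 < s \/ 0 <= r ->
  dot (u + s *: hat v) d + r * dot v (hat x) <= 0.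
Proof.
move=> x0 qx s0 /regular_normal_tangent H dx sr.
have := H _ (tangent_boundary x0 qx dx s0 sr).
by rewrite dot_row_mx !dotE dot_hatC addrA.
Qed.

(** With [r = 0] both [d] and [- d] are admissible, so the polar inequality is an equality on the
    complement of [hat x]. *)
Lemma regular_normal_bd_line x s u v : 0 < hd x -> qf x = 0 -> 0 <= s ->
  regular_normal_cone Omega (row_mx x (s *: hat x)) (row_mx u v) ->
  exists c, u + s *: hat v = c *: hat x.
Proof.
move=> x0 qx s0 H; eexists; apply: line_dotP; first exact: hd_gt0_hat_neq0.
move=> d; rewrite dotC => dx.
have h1 := regular_normal_bd (r := 0) x0 qx s0 H dx (or_intror (lexx _)).
have dx' : dot (- d) (hat x) = 0 by rewrite dotNl dx oppr0.
have h2 := regular_normal_bd (r := 0) x0 qx s0 H dx' (or_intror (lexx _)).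
move: h1 h2; rewrite !mul0r !addr0 dotNr; lra.
Qed.

Lemma regular_normal_smooth_inv x s u v : 0 < hd x -> qf x = 0 -> 0 < s ->
  regular_normal_cone Omega (row_mx x (s *: hat x)) (row_mx u v) ->
  smooth_normal x s u v.
Proof.
move=> x0 qx s0 H; split.
  have d0 := dot0l (hat x).
  have h1 := regular_normal_bd (r := 1) x0 qx (ltW s0) H d0 (or_introl s0).
  (* Decreasing the coefficient is allowed because [s > 0]; at a corner only [r = 1] remains,
     leaving an inequality. *)
  have h2 := regular_normal_bd (r := -1) x0 qx (ltW s0) H d0 (or_introl s0).
  move: h1 h2; rewrite !dot0r; lra.
have [c cE] := regular_normal_bd_line x0 qx (ltW s0) H.
by exists c; rewrite -cE addrK.
Qed.

Lemma regular_normal_corner_inv x u v : 0 < hd x -> qf x = 0 ->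
  regular_normal_cone Omega (row_mx x 0) (row_mx u v) -> corner_normal x u v.
Proof.
move=> x0 qx H0; have H := H0; rewrite -(scale0r (hat x)) in H; split.
  have := regular_normal_bd (r := 1) x0 qx (lexx _) H (dot0l _) (or_intror ler01).
  by rewrite dot0r add0r mul1r.
have [c] := regular_normal_bd_line x0 qx (lexx _) H.
rewrite scale0r addr0 => uE; exists (- c); last by rewrite scaleNr opprK.
have xx : 0 < dot (hat x) (hat x) by rewrite dot_gt0// hd_gt0_hat_neq0.
(* The inward tangent [(hat x, 0)] fixes the sign of the coefficient. *)
have T := tangent_interior (d := hat x) x0 (or_intror (conj qx (ltW xx))).
have := regular_normal_tangent H0 T; rewrite dot_row_mx dot0r addr0 uE dotZl.
by rewrite pmulr_lle0// oppr_ge0.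
Qed.

End ChartNormals.

(** * Limiting normals and tangents in the chart *)

(** Passing to a subsequence, phrased with filters: if [P] is not eventually false, [within P \oo]
    is a proper filter on which [P] holds. *)
Lemma frequently_or (P Q : nat -> Prop) : (\forall k \near \oo, P k \/ Q k) ->
  (exists F : set_system nat, [/\ ProperFilter F, F --> \oo & \forall k \near F, P k])
  \/ \forall k \near \oo, Q k.
Proof.
move=> PQ; have [nP|nP] := pselect (\forall k \near \oo, ~ P k).
  by right; apply: filterS2 PQ nP => k [].
left; exists (within P \oo); split; last exact: withinT.
- by apply: Build_ProperFilter => /= h; apply: nP.
- exact: cvg_within.
Qed.

Section ChartLimits.
Context {R : realType} {n : nat}.
Notation V := 'rV[R]_n.+1.
Notation VV := 'rV[R]_(n.+1 + n.+1).
Notation Omega := (@soc_compl R n).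
Implicit Types (x y d w u v : V) (z : VV) (s r c a : R) (t : nat -> R).

Definition slope z : R := hd (rsubmx z) / hd (lsubmx z).

Lemma regular_normal_cases z (nv : VV) : 0 < hd (lsubmx z) ->
  regular_normal_cone Omega z nv ->
  [\/ 0 < qf (lsubmx z) /\ slope z = 0 /\ lsubmx nv = 0,
      qf (lsubmx z) = 0 /\ 0 < slope z /\
        smooth_normal (lsubmx z) (slope z) (lsubmx nv) (rsubmx nv)
    | qf (lsubmx z) = 0 /\ slope z = 0 /\
        corner_normal (lsubmx z) (lsubmx nv) (rsubmx nv)].
Proof.
rewrite -{2}(hsubmxK z) -{1}(hsubmxK nv) /slope.
move: (lsubmx z) (rsubmx z) (lsubmx nv) (rsubmx nv) => x y u v x0 H.
have [qx] := soc_compl_chart x0 H.1; set s := _ / _ => s0 sq yE.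
rewrite yE in H; move: qx; rewrite le_eqVlt => /orP[/eqP/esym qx|qx].
  move: s0; rewrite le_eqVlt => /orP[/eqP/esym s0|s0].
    apply: Or33; split=> //; split=> //.
    by rewrite s0 scale0r in H; exact: regular_normal_corner_inv H.
  by apply: Or32; split=> //; split=> //; exact: regular_normal_smooth_inv H.
have s_0 : s = 0 by apply/eqP; move/eqP: sq; rewrite mulf_eq0 (gt_eqF qx) orbF.
apply: Or31; split=> //; split=> //.
by rewrite s_0 scale0r in H; exact: regular_normal_int_inv H.
Qed.

Variables (x : V) (s : R).
Hypothesis x0 : 0 < hd x.
Section Sequences.
Variables (z_ nv_ : nat -> VV) (u v : V).
Hypothesis cz : z_ @ \oo --> row_mx x (s *: hat x).

Lemma chart_cvg : [/\ (fun k => lsubmx (z_ k)) @ \oo --> x,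
  (fun k => slope (z_ k)) @ \oo --> s & \forall k \near \oo, 0 < hd (lsubmx (z_ k))].
Proof.
have cl : (fun k => lsubmx (z_ k)) @ \oo --> x.
  by rewrite -(row_mxKl x (s *: hat x)); exact: cvg_lsub.
have cr : (fun k => rsubmx (z_ k)) @ \oo --> s *: hat x.
  by rewrite -(row_mxKr x (s *: hat x)); exact: cvg_rsub.
split=> //; first exact: (cvg_slope x0 cl cr).
exact: (cvgr_gt _ (cvg_hd cl)).
Qed.

Hypothesis cnv : nv_ @ \oo --> row_mx u v.
Hypothesis zP : forall k, regular_normal_cone Omega (z_ k) (nv_ k).

Let cu : (fun k => lsubmx (nv_ k)) @ \oo --> u.
Proof. by rewrite -(row_mxKl u v); exact: cvg_lsub. Qed.

Let cv : (fun k => rsubmx (nv_ k)) @ \oo --> v.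
Proof. by rewrite -(row_mxKr u v); exact: cvg_rsub. Qed.

Lemma limit_of_int : (\forall k \near \oo, 0 < qf (lsubmx (z_ k))) -> u = 0.
Proof.
move=> q_gt0; have [_ _ x_gt0] := chart_cvg.
apply: (cvg_near_unique cu (@cvg_cst _ (0 : V) _ \oo _)).
apply: filterS2 q_gt0 x_gt0 => k qk xk.
by case: (regular_normal_cases xk (zP k)) => [[_ []]//|[q0]|[q0]];
  rewrite q0 ltxx in qk.
Qed.

Lemma limit_of_smooth : (\forall k \near \oo, 0 < slope (z_ k)) -> smooth_normal x s u v.
Proof.
move=> s_gt0; have [cx cs x_gt0] := chart_cvg.
apply: (limit_smooth x0 cx cs cu cv).
apply: filterS2 s_gt0 x_gt0 => k sk xk.
by case: (regular_normal_cases xk (zP k)) => [[_ [s_0]]|[_ []]//|[_ [s_0]]];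
  rewrite s_0 ltxx in sk.
Qed.

(** At least one of the three strata is visited along a proper filter finer than [\oo], and its
    closed condition passes to the limit there. *)
Lemma limit_of_any : [\/ u = 0, smooth_normal x s u v | corner_normal x u v].
Proof.
have [cx cs x_gt0] := chart_cvg.
have cases : \forall k \near \oo, lsubmx (nv_ k) = 0 \/
    (smooth_normal (lsubmx (z_ k)) (slope (z_ k)) (lsubmx (nv_ k)) (rsubmx (nv_ k)) \/
    corner_normal (lsubmx (z_ k)) (lsubmx (nv_ k)) (rsubmx (nv_ k))).
  apply: filterS x_gt0 => k xk.
  by case: (regular_normal_cases xk (zP k)) => [[_ []]|[_ []]|[_ []]]; tauto.
have sub (F : set_system nat) (W : topologicalType) (f : nat -> W) (a : W) :
    F --> \oo -> f @ \oo --> a -> f @ F --> a.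
  by move=> Foo; apply: cvg_trans; exact: cvg_app.
case: (frequently_or cases) => [[F [FF Foo H]]|{}cases].
  apply: Or31; apply: (cvg_near_unique (sub _ _ _ _ Foo cu) (@cvg_cst _ (0 : V) _ F _)).
  exact: H.
case: (frequently_or cases) => [[F [FF Foo H]]|H].
  by apply: Or32; apply: (limit_smooth x0 (sub _ _ _ _ Foo cx) (sub _ _ _ _ Foo cs)
    (sub _ _ _ _ Foo cu) (sub _ _ _ _ Foo cv) H).
by apply: Or33; exact: (limit_corner x0 cx cu cv H).
Qed.

End Sequences.

Lemma tangent_seq y d w : tangent_cone Omega (row_mx x y) (row_mx d w) ->
  exists t (d_ w_ : nat -> V), [/\ down0 t, d_ @ \oo --> d, w_ @ \oo --> w
    & forall k, Omega (row_mx (x + t k *: d_ k) (y + t k *: w_ k))].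
Proof.
move=> [t [e_ [t0 ce eP]]]; exists t, (fun k => lsubmx (e_ k)), (fun k => rsubmx (e_ k)).
split=> //.
- by rewrite -(row_mxKl d w); exact: cvg_lsub.
- by rewrite -(row_mxKr d w); exact: cvg_rsub.
- by move=> k; rewrite -step_row_mx hsubmxK.
Qed.

(** After division by [a = t k], the bracket tends to [2 <d, hat x>]; signs of [qf] along a path
    thereby become conditions on [d], and conversely when [<d, hat x> > 0]. *)
Lemma qf_step d a : qf x = 0 ->
  qf (x + a *: d) = a * (2 * dot d (hat x) + a * qf d).
Proof. by move=> qx; rewrite qfD qfZ qx dotZr (dotC (hat x)); ring. Qed.

Lemma cvg_qf_step t (d_ : nat -> V) d : down0 t -> d_ @ \oo --> d ->
  (fun k => 2 * dot (d_ k) (hat x) + t k * qf (d_ k)) @ \oo --> 2 * dot d (hat x).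
Proof.
move=> t0 cd; rewrite -[X in _ --> X]addr0 -(mul0r (qf d)); apply: cvg_add.
  by apply: cvg_mul; [exact: cvg_cst|apply: cvg_dot => //; exact: cvg_cst].
by apply: cvg_mul; [exact: t0.2|exact: cvg_qf].
Qed.

Lemma step_bd_orth t (d_ : nat -> V) d : qf x = 0 -> down0 t -> d_ @ \oo --> d ->
  (\forall k \near \oo, qf (x + t k *: d_ k) = 0) -> dot d (hat x) = 0.
Proof.
move=> qx t0 cd H; have c2 := cvg_qf_step t0 cd.
have /eqP : 2 * dot d (hat x) = 0.
  apply: (@cvg_near_unique _ _ _ _ R^o _ (fun=> 0) _ _ c2); first exact: cvg_cst.
  apply: filterS H => k /eqP; rewrite qf_step// mulf_eq0 gt_eqF ?(t0.1 k)//=.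
  by move/eqP.
by rewrite mulf_eq0 pnatr_eq0/= => /eqP.
Qed.

Lemma step_soc_ge0 t (d_ : nat -> V) d : qf x = 0 -> down0 t -> d_ @ \oo --> d ->
  (forall k, soc (x + t k *: d_ k)) -> 0 <= dot d (hat x).
Proof.
move=> qx t0 cd H; have c2 := cvg_qf_step t0 cd.
suff : 0 <= 2 * dot d (hat x) by rewrite pmulr_rge0.
apply: (@cvgr_to_ge _ \oo _ _ _ _ _ c2); near=> k.
by have /socP[_] := H k; rewrite qf_step// pmulr_rge0// (t0.1 k).
Unshelve. all: by end_near. Qed.

Lemma step_interior t (d_ : nat -> V) d : qf x = 0 -> down0 t -> d_ @ \oo --> d ->
  0 < dot d (hat x) -> \forall k \near \oo, 0 < qf (x + t k *: d_ k).
Proof.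
move=> qx t0 cd dx; have c2 := cvg_qf_step t0 cd.
have H : \forall k \near \oo, 0 < 2 * dot (d_ k) (hat x) + t k * qf (d_ k).
  by apply: (cvgr_gt _ c2); rewrite mulr_gt0.
by apply: filterS H => k qk; rewrite qf_step// mulr_gt0// (t0.1 k).
Qed.

(** This is [y = s hat x] differentiated along the sequence; the coefficient of [hat x] is the limit
    of the difference quotients of the slope, computed from first coordinates. *)
Lemma tangent_coord d w :
  tangent_cone Omega (row_mx x (s *: hat x)) (row_mx d w) ->
  w = s *: hat d + ((hd w - s * hd d) / hd x) *: hat x.
Proof.
move=> /tangent_seq[t [d_ [w_ [t0 cd cw H]]]].
have cx : (fun k => x + t k *: d_ k) @ \oo --> x by exact: cvg_step cd.
have cR : (fun k => s *: hat (d_ k) + ((hd (w_ k) - s * hd (d_ k)) /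
    hd (x + t k *: d_ k)) *: hat (x + t k *: d_ k)) @ \oo -->
    s *: hat d + ((hd w - s * hd d) / hd x) *: hat x.
  apply: cvg_add; first by apply: cvgZ; [exact: cvg_cst|exact: cvg_hat].
  apply: cvgZ; last exact: cvg_hat.
  apply: cvg_mul; last by apply: cvgV; [rewrite lt0r_neq0|exact: cvg_hd].
  apply: cvgB; first exact: cvg_hd.
  by apply: cvg_mul; [exact: cvg_cst|exact: cvg_hd].
apply: (cvg_near_unique cw cR).
apply: filterS (soc_near x0 t0 cd) => k xk; have tk := t0.1 k.
have [_ _ _] := soc_compl_chart xk (H k).
set xk' := x + _ in xk *; set s' := _ / _ => yE.
have s'E : s' = s + t k * ((hd (w_ k) - s * hd (d_ k)) / hd xk').
  have -> : s' = (s * hd x + t k * hd (w_ k)) / hd xk'.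
    by rewrite /s'; congr (_ / _); rewrite /hd !dotE -/(hd _) hd_hat.
  have hx : hd xk' = hd x + t k * hd (d_ k) by rewrite /hd !dotE.
  rewrite hx in xk *; field; exact: lt0r_neq0.
apply: (scalerI (lt0r_neq0 tk)).
rewrite -[LHS](addKr (s *: hat x)) yE s'E scalerDl scalerDr [t k *: (_ *: hat xk')]scalerA.
rewrite addrA; congr (_ + _).
by rewrite /xk' hatD hatZ scalerDr addKr !scalerA mulrC.
Qed.

Lemma tangent_int d w : 0 < qf x ->
  tangent_cone Omega (row_mx x 0) (row_mx d w) -> w = 0.
Proof.
move=> qx /tangent_seq[t [d_ [w_ [t0 cd cw H]]]].
have cx : (fun k => x + t k *: d_ k) @ \oo --> x by exact: cvg_step cd.
apply: (cvg_near_unique cw (@cvg_cst _ (0 : V) _ \oo _)).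
have q_gt0 : \forall k \near \oo, 0 < qf (x + t k *: d_ k).
  exact: (cvgr_gt _ (cvg_qf cx)).
apply: filterS2 (soc_near x0 t0 cd) q_gt0 => k xk qk; have tk := t0.1 k.
have [_ _ /eqP] := soc_compl_chart xk (H k).
rewrite mulf_eq0 (gt_eqF qk) orbF => /eqP ->; rewrite scale0r add0r => /eqP.
by rewrite scaler_eq0 gt_eqF//= => /eqP.
Qed.

(** Once the second component has positive [hd], complementarity puts the first one on the boundary,
    where [step_bd_orth] applies. *)
Lemma tangent_hd_gt0 y d w : qf x = 0 ->
  tangent_cone Omega (row_mx x y) (row_mx d w) ->
  0 < hd y \/ (hd y = 0 /\ 0 < hd w) -> dot d (hat x) = 0.
Proof.
move=> qx /tangent_seq[t [d_ [w_ [t0 cd cw H]]]] yw.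
apply: (step_bd_orth qx t0 cd).
have y_gt0 : \forall k \near \oo, 0 < hd (y + t k *: w_ k).
  case: yw => [y_gt0|[y0 w0]]; first exact: (soc_near y_gt0 t0 cw).
  have w_gt0 : \forall k \near \oo, 0 < hd (w_ k).
    exact: (cvgr_gt _ (cvg_hd cw)).
  apply: filterS w_gt0 => k wk; have tk := t0.1 k.
  by rewrite /hd !dotE -!/(hd _) y0 add0r mulr_gt0.
apply: filterS2 (soc_near x0 t0 cd) y_gt0 => k xk yk.
have [_ _ /eqP sq _] := soc_compl_chart xk (H k).
by move: sq; rewrite mulf_eq0 gt_eqF ?divr_gt0//= => /eqP.
Qed.

Lemma tangent_corner_ge0 d w : qf x = 0 ->
  tangent_cone Omega (row_mx x 0) (row_mx d w) -> 0 <= dot d (hat x) /\ 0 <= hd w.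
Proof.
move=> qx /tangent_seq[t [d_ [w_ [t0 cd cw H]]]]; split.
  apply: (step_soc_ge0 qx t0 cd) => k.
  by have := H k; rewrite /soc_compl pairset_row_mx => -[].
apply: (@cvgr_to_ge _ \oo _ _ _ _ _ (cvg_hd cw)); near=> k.
have := H k; rewrite /soc_compl pairset_row_mx => -[_ /socP[+ _] _].
by rewrite add0r /hd dotZl pmulr_rge0// (t0.1 k).
Unshelve. all: by end_near. Qed.

End ChartLimits.

(** * Topology of the cone, symmetry, directional regularity *)

Section ConeTopology.
Context {R : realType} {n : nat}.
Notation V := 'rV[R]_n.+1.
Implicit Types (x d : V).

Lemma continuous_hd : continuous (@hd R n).
Proof.
move=> x; have cx : id @ x --> x by exact: cvg_id.
exact: (cvg_hd cx).
Qed.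

Lemma continuous_qf : continuous (@qf R n).
Proof.
move=> x; have cx : id @ x --> x by exact: cvg_id.
exact: (cvg_qf cx).
Qed.

Lemma closed_soc : closed (@soc R n).
Proof.
have -> : @soc R n = (hd @^-1` [set a | 0 <= a]) `&` (qf @^-1` [set a | 0 <= a]).
  by apply/seteqP; split=> x /=; rewrite socP.
by apply: closedI; apply: closed_comp (@closed_ge R 0) => x _;
  [exact: continuous_hd|exact: continuous_qf].
Qed.

Lemma interior_step (A : set V) x d : A° x ->
  exists2 a : R, 0 < a & A (x + a *: d).
Proof.
move=> Ax; have [t t0] := @down0_exists R.
have cx : (fun k => x + t k *: d) @ \oo --> x by apply: cvg_step t0 (@cvg_cst _ d _ _ _).
have [k Ak] : exists k, A (x + t k *: d) by exact: (filter_ex (cvg_near cx Ax)).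
by exists (t k) => //; exact: t0.1.
Qed.

Lemma interior_soc x : (@soc R n)° x <-> 0 < hd x /\ 0 < qf x.
Proof.
(* Lowering [x] by [a e1] inside the cone gives [hd x >= a] and [qf x >= a * (2 * hd x - a)], which
   is positive. *)
split=> [/(@interior_step _ _ (- e1))[a a0]|[x0 qx]].
  move=> /socP; rewrite !qfE /hd !dotE !dot_e1 (dotC e1) => -[h q].
  have x0 : 0 < dot x e1 by lra.
  split=> //; have := mulr_gt0 a0 x0; have := mulr_gt0 a0 a0; nra.
have h0 : \forall x' \near x, 0 < hd x' by exact: (cvgr_gt _ (@continuous_hd x)).
have q0 : \forall x' \near x, 0 < qf x' by exact: (cvgr_gt _ (@continuous_qf x)).
by apply: filterS2 h0 q0 => x' /ltW h /ltW q; apply/socP.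
Qed.

Lemma bd_soc0 x : (bd (@soc R n) `\` [set 0]) x <-> 0 < hd x /\ qf x = 0.
Proof.
rewrite /bd -((closure_id _).1 closed_soc); split=> [[[xK xI] x0]|[x0 qx]].
  have [h q] := (socP x).1 xK.
  have h0 : 0 < hd x.
    rewrite lt_def h andbT; apply/eqP => hx; apply: x0; exact: soc_hd_eq0 hx.
  split=> //; apply/eqP; rewrite eq_le q andbT leNgt; apply/negP => q0.
  by apply: xI; apply/interior_soc.
split; first split.
- by apply/socP; rewrite qx ltW.
- by move=> /interior_soc[_]; rewrite qx ltxx.
- by move=> /= x_0; move: x0; rewrite x_0 /hd dot0l ltxx.
Qed.

(** For the inclusion from right to left, project the tangent [(d, 0)] of [Omega] at [(x, 0)] to its
    first component. *)
Lemma tangent_cone_soc x : 0 < hd x -> qf x = 0 ->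
  tangent_cone (@soc R n) x = [set d | 0 <= dot d (hat x)].
Proof.
move=> x0 qx; apply/seteqP; split=> d /=.
  by move=> [t [d_ [t0 cd H]]]; exact: step_soc_ge0 t0 cd H.
move=> dx; have := tangent_interior x0 (or_intror (conj qx dx)).
move=> /tangent_seq[t [d_ [w_ [t0 cd cw H]]]]; exists t, d_; split => // k.
by have := H k; rewrite /soc_compl pairset_row_mx => -[].
Qed.

Lemma interior_tangent_cone_soc x d : 0 < hd x -> qf x = 0 ->
  (tangent_cone (@soc R n) x)° d <-> 0 < dot d (hat x).
Proof.
move=> x0 qx; rewrite tangent_cone_soc//; split=> [|dx].
  move=> /(@interior_step _ _ (- hat x))[a a0] /=; rewrite !dotE => h.
  have xx : 0 < dot (hat x) (hat x) by rewrite dot_gt0// hd_gt0_hat_neq0.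
  by have := mulr_gt0 a0 xx; lra.
have cd : id @ d --> d by exact: cvg_id.
have cdx : (fun d' => dot d' (hat x)) @ d --> dot d (hat x).
  exact: (cvg_dot cd (cvg_cst _)).
have H : \forall d' \near d, 0 < dot d' (hat x) by exact: (cvgr_gt _ cdx).
by apply: filterS H => d' /ltW.
Qed.

Lemma bd_tangent_cone_soc x d : 0 < hd x -> qf x = 0 ->
  bd (tangent_cone (@soc R n) x) d <-> dot d (hat x) = 0.
Proof.
move=> x0 qx; have cT : closed (tangent_cone (@soc R n) x).
  rewrite tangent_cone_soc//.
  apply: (@closed_comp _ _ (fun d => dot d (hat x)) _ _ (@closed_ge R 0)) => d' _.
  have cd : id @ d' --> d' by exact: cvg_id.
  exact: (cvg_dot cd (cvg_cst _)).
rewrite /bd -((closure_id _).1 cT); split=> [[]|dx].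
  rewrite {1}tangent_cone_soc//= interior_tangent_cone_soc// => h /negP.
  by rewrite -leNgt => h'; apply/eqP; rewrite eq_le h h'.
split; first by rewrite tangent_cone_soc//= dx.
by rewrite interior_tangent_cone_soc// dx ltxx.
Qed.

End ConeTopology.

(** * The symmetry exchanging [x] and [y] *)

Section Swap.
Context {R : realType} {n : nat}.
Notation V := 'rV[R]_n.+1.
Notation VV := 'rV[R]_(n.+1 + n.+1).
Notation Omega := (@soc_compl R n).
Implicit Types (x y d w u v : V).

Definition swap : {linear VV -> VV} :=
  mulmxr (block_mx (0 : 'M[R]_n.+1) 1%:M 1%:M (0 : 'M[R]_n.+1)).

Lemma swap_row_mx x y : swap (row_mx x y) = row_mx y x.
Proof. by rewrite /= mul_row_block !mulmx0 !mulmx1 add0r addr0. Qed.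

Lemma swapK : involutive swap.
Proof. by move=> z; rewrite -(hsubmxK z) !swap_row_mx. Qed.

Lemma dot_swap z z' : dot (swap z) (swap z') = dot z z'.
Proof.
by rewrite -(hsubmxK z) -(hsubmxK z') !swap_row_mx !dot_row_mx addrC.
Qed.

Lemma soc_compl_swap z : Omega z -> Omega (swap z).
Proof.
rewrite -(hsubmxK z) swap_row_mx /soc_compl !pairset_row_mx.
by move=> [xK yK xy]; split=> //; rewrite dotC.
Qed.

Lemma tangent_cone_swap x y d w :
  tangent_cone Omega (row_mx x y) (row_mx d w) ->
  tangent_cone Omega (row_mx y x) (row_mx w d).
Proof.
by move=> /(tangent_cone_isometry soc_compl_swap); rewrite !swap_row_mx.
Qed.

Lemma limiting_normal_cone_swap x y u v :
  limiting_normal_cone Omega (row_mx x y) (row_mx u v) <->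
  limiting_normal_cone Omega (row_mx y x) (row_mx v u).
Proof.
by split=> /(limiting_normal_cone_isometry swapK dot_swap soc_compl_swap);
  rewrite !swap_row_mx.
Qed.

Lemma dir_normal_cone_swap x y d w u v :
  dir_normal_cone Omega (row_mx x y) (row_mx d w) (row_mx u v) <->
  dir_normal_cone Omega (row_mx y x) (row_mx w d) (row_mx v u).
Proof.
by split=> /(dir_normal_cone_isometry swapK dot_swap soc_compl_swap);
  rewrite !swap_row_mx.
Qed.

Lemma inner_dir_normal_cone_swap x y d w u v :
  inner_dir_normal_cone Omega (row_mx x y) (row_mx d w) (row_mx u v) ->
  inner_dir_normal_cone Omega (row_mx y x) (row_mx w d) (row_mx v u).
Proof.
by move=> /(inner_dir_normal_cone_isometry swapK dot_swap soc_compl_swap);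
  rewrite !swap_row_mx.
Qed.

End Swap.

(** * Directional normals in the chart, and directional regularity *)

Section ChartDirectional.
Context {R : realType} {n : nat}.
Notation V := 'rV[R]_n.+1.
Notation VV := 'rV[R]_(n.+1 + n.+1).
Notation Omega := (@soc_compl R n).
Implicit Types (x y d w u v : V) (s r : R) (A : set VV).

Lemma subset_pairs A (B : set VV) :
  (forall u v, A (row_mx u v) -> B (row_mx u v)) -> A `<=` B.
Proof. by move=> AB z; rewrite -(hsubmxK z); exact: AB. Qed.

Lemma limiting_int x : 0 < hd x -> 0 < qf x ->
  limiting_normal_cone Omega (row_mx x 0) `<=` pairset (fun u v => u = 0).
Proof.
move=> x0 qx; apply: subset_pairs => u v [z_ [nv_ [cz cnv _ zP]]].
rewrite pairset_row_mx; rewrite -(scale0r (hat x)) in cz.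
apply: (limit_of_int x0 cz cnv zP); have [cx _ _] := chart_cvg x0 cz.
exact: (cvgr_gt _ (cvg_qf cx)).
Qed.

Lemma int_inner x d w : 0 < hd x -> 0 < qf x ->
  tangent_cone Omega (row_mx x 0) (row_mx d w) ->
  pairset (fun u v => u = 0) `<=`
  inner_dir_normal_cone Omega (row_mx x 0) (row_mx d w).
Proof.
move=> x0 qx T; apply: subset_pairs => u v; rewrite pairset_row_mx => ->.
by rewrite (tangent_int x0 qx T); apply: inner_normal_int => //; left.
Qed.

(** Nearby points have positive slope, so limiting normals are smooth ones; every tangent has the
    form followed by [inner_normal_smooth]. *)
Lemma smooth_limiting_sub_inner x s d w : 0 < hd x -> qf x = 0 -> 0 < s ->
  tangent_cone Omega (row_mx x (s *: hat x)) (row_mx d w) ->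
  limiting_normal_cone Omega (row_mx x (s *: hat x)) `<=`
  inner_dir_normal_cone Omega (row_mx x (s *: hat x)) (row_mx d w).
Proof.
move=> x0 qx s0 T; apply: subset_pairs => u v [z_ [nv_ [cz cnv _ zP]]].
have dx : dot d (hat x) = 0.
  apply: (tangent_hd_gt0 x0 qx T); left.
  by rewrite /hd dotZl -/(hd _) hd_hat mulr_gt0.
rewrite (tangent_coord x0 T); apply: inner_normal_smooth => //; first exact: ltW.
  by left.
apply: (limit_of_smooth x0 cz cnv zP); have [_ cs _] := chart_cvg x0 cz.
exact: (cvgr_gt _ cs).
Qed.

(** Points approached along such a direction eventually have [qf > 0]. *)
Lemma corner_dir_int x d : 0 < hd x -> qf x = 0 -> 0 < dot d (hat x) ->
  dir_normal_cone Omega (row_mx x 0) (row_mx d 0) `<=` pairset (fun u v => u = 0).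
Proof.
move=> x0 qx dx; apply: subset_pairs => u v [t [e_ [nv_ [t0 ce cnv zP]]]].
rewrite pairset_row_mx; have cz := cvg_step (z := row_mx x 0) t0 ce.
rewrite -[X in _ --> row_mx _ X](scale0r (hat x)) in cz.
apply: (limit_of_int x0 cz cnv zP).
have cd : (fun k => lsubmx (e_ k)) @ \oo --> d.
  by rewrite -(row_mxKl d (0 : V)); exact: cvg_lsub.
have H : \forall k \near \oo, 0 < qf (x + t k *: lsubmx (e_ k)).
  exact: step_interior cd dx.
apply: filterS H => k.
by rewrite -{2}(hsubmxK (e_ k)) step_row_mx row_mxKl.
Qed.

(** Along a direction [(d, 0)] with [<d, hat x> = 0] all three strata can be followed, the open and
    the smooth one through perturbations of order [t k ^+ 2]; so each kind of limiting normal is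
    attained. *)
Lemma corner_limiting_sub_inner x d : 0 < hd x -> qf x = 0 -> dot d (hat x) = 0 ->
  limiting_normal_cone Omega (row_mx x 0) `<=`
  inner_dir_normal_cone Omega (row_mx x 0) (row_mx d 0).
Proof.
move=> x0 qx dx; apply: subset_pairs => u v [z_ [nv_ [cz cnv _ zP]]].
rewrite -(scale0r (hat x)) in cz.
case: (limit_of_any x0 cz cnv zP) => [->|N|N].
- by apply: inner_normal_int => //; right; rewrite dx.
- have := inner_normal_smooth x0 qx dx (lexx 0) (or_intror (lexx 0)) N.
  by rewrite !scale0r addr0.
- exact: inner_normal_corner.
Qed.

(** A nonzero second direction makes the slope eventually positive, so only smooth normals survive,
    taken at [s = 0]. *)
Lemma corner_dir_smooth x d r : 0 < hd x -> qf x = 0 -> 0 < r ->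
  dir_normal_cone Omega (row_mx x 0) (row_mx d (r *: hat x)) `<=`
  pairset (fun u v => line (hat x) u /\ orth v (hat x)).
Proof.
move=> x0 qx r0; apply: subset_pairs => u v [t [e_ [nv_ [t0 ce cnv zP]]]].
rewrite pairset_row_mx; have cz := cvg_step (z := row_mx x 0) t0 ce.
rewrite -[X in _ --> row_mx _ X](scale0r (hat x)) in cz.
have [vx [c uE]] : smooth_normal x 0 u v.
  apply: (limit_of_smooth x0 cz cnv zP).
  have cw : (fun k => rsubmx (e_ k)) @ \oo --> r *: hat x.
    by rewrite -(row_mxKr d (r *: hat x)); exact: cvg_rsub.
  have w_gt0 : \forall k \near \oo, 0 < hd (rsubmx (e_ k)).
    apply: (cvgr_gt _ (cvg_hd cw)).
    by rewrite /hd dotZl -/(hd _) hd_hat mulr_gt0.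
  have [_ _ x_gt0] := chart_cvg x0 cz.
  apply: filterS2 w_gt0 x_gt0 => k wk; rewrite /slope.
  rewrite -(hsubmxK (e_ k)) step_row_mx row_mxKl row_mxKr add0r => xk.
  by rewrite divr_gt0// /hd dotZl mulr_gt0// (t0.1 k).
by split=> //; exists c => //; rewrite uE scale0r subr0.
Qed.

Lemma corner_smooth_inner x d r : 0 < hd x -> qf x = 0 -> dot d (hat x) = 0 -> 0 <= r ->
  pairset (fun u v => line (hat x) u /\ orth v (hat x)) `<=`
  inner_dir_normal_cone Omega (row_mx x 0) (row_mx d (r *: hat x)).
Proof.
move=> x0 qx dx r0; apply: subset_pairs => u v; rewrite pairset_row_mx.
move=> [[c _ uE] vx]; have N : smooth_normal x 0 u v.
  by split=> //; exists c; rewrite scale0r subr0.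
have := inner_normal_smooth x0 qx dx (lexx 0) (or_intror r0) N.
by rewrite !scale0r add0r.
Qed.

Lemma corner_tangent_cases x d w : 0 < hd x -> qf x = 0 ->
  tangent_cone Omega (row_mx x 0) (row_mx d w) ->
  [\/ 0 < dot d (hat x) /\ w = 0, dot d (hat x) = 0 /\ w = 0
    | dot d (hat x) = 0 /\ exists2 r, 0 < r & w = r *: hat x].
Proof.
move=> x0 qx T; have [dx w0] := tangent_corner_ge0 qx T.
have wE : w = (hd w / hd x) *: hat x.
  have T' := T; rewrite -(scale0r (hat x)) in T'.
  by have := tangent_coord x0 T'; rewrite scale0r add0r mul0r subr0.
move: w0; rewrite le_eqVlt => /orP[/eqP/esym w0|w0].
  have w_0 : w = 0 by rewrite wE w0 mul0r scale0r.
  by move: dx; rewrite le_eqVlt => /orP[/eqP/esym dx|dx]; [apply: Or32|apply: Or31].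
apply: Or33; split; last by exists (hd w / hd x); rewrite ?divr_gt0.
by apply: (tangent_hd_gt0 x0 qx T); right; rewrite {1}/hd dot0l.
Qed.

Lemma chart_regular x y d w : 0 < hd x -> Omega (row_mx x y) ->
  dir_normal_cone Omega (row_mx x y) (row_mx d w) `<=`
  inner_dir_normal_cone Omega (row_mx x y) (row_mx d w).
Proof.
move=> x0 Oxy nv Hnv; have T := dir_normal_cone_tangent Hnv.
have [+ + sq yE] := soc_compl_chart x0 Oxy; move: sq yE Hnv T.
set s := _ / _ => sq -> Hnv T qx s0.
move: s0; rewrite le_eqVlt => /orP[/eqP/esym s0|s0]; last first.
  have qx0 : qf x = 0 by move/eqP: sq; rewrite mulf_eq0 gt_eqF//= => /eqP.
  exact: (smooth_limiting_sub_inner x0 qx0 s0 T (dir_normal_cone_sub Hnv)).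
move: Hnv T; rewrite s0 scale0r => Hnv T.
move: qx; rewrite le_eqVlt => /orP[/eqP/esym qx|qx]; last first.
  exact: (int_inner x0 qx T (limiting_int x0 qx (dir_normal_cone_sub Hnv))).
case: (corner_tangent_cases x0 qx T) Hnv => [[dx ->]|[dx ->]|[dx [r r0 ->]]] Hnv.
- have /corner_dir_int := Hnv; move=> /(_ x0 qx dx).
  move: nv Hnv => nv _; rewrite -(hsubmxK nv) pairset_row_mx => ->.
  by apply: inner_normal_int => //; right; rewrite ltW.
- exact: (corner_limiting_sub_inner x0 qx dx (dir_normal_cone_sub Hnv)).
- exact: (corner_smooth_inner x0 qx dx (ltW r0) (corner_dir_smooth x0 qx r0 Hnv)).
Qed.

Lemma soc_complZ (a : R) (z : VV) : 0 < a -> Omega z -> Omega (a *: z).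
Proof.
rewrite -(hsubmxK z) scale_row_mx /soc_compl !pairset_row_mx => a0 [? ? h].
by split; [apply: socZ => //; exact: ltW..|rewrite !dotE h !mulr0].
Qed.

Lemma soc_compl_directionally_regular : directionally_regular Omega.
Proof.
move=> z e Oz; apply/seteqP; split; last exact: inner_dir_normal_cone_sub.
move: Oz; rewrite -(hsubmxK z) -(hsubmxK e).
move: (lsubmx z) (rsubmx z) (lsubmx e) (rsubmx e) => x y d w Oxy.
have := Oxy; rewrite /soc_compl pairset_row_mx => -[xK yK xy].
have [x0 _] := (socP x).1 xK; have [y0 _] := (socP y).1 yK.
move: x0; rewrite le_eqVlt => /orP[/eqP/esym/(soc_hd_eq0 xK) x0|x0]; last first.
  exact: chart_regular.
move: y0; rewrite le_eqVlt => /orP[/eqP/esym/(soc_hd_eq0 yK) y0|y0]; last first.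
  apply: subset_pairs => u v /dir_normal_cone_swap H.
  apply: inner_dir_normal_cone_swap; apply: chart_regular H => //.
  by rewrite -swap_row_mx; exact: soc_compl_swap.
have OZ := @soc_complZ.
rewrite x0 y0 row_mx0 => nv Hnv; apply: limiting_sub_inner_dir_normal_cone0 => //.
exact: dir_sub_limiting_normal_cone0 Hnv.
Qed.

End ChartDirectional.

(** * The formulas for the individual cases and their exhaustiveness *)

Section Cases.
Context {R : realType} {n : nat}.
Notation V := 'rV[R]_n.+1.
Notation VV := 'rV[R]_(n.+1 + n.+1).
Notation K := (@soc R n).
Notation Omega := (@soc_compl R n).
Implicit Types (x y d w u v : V) (s r : R).

Lemma int_case x d w : 0 < hd x -> 0 < qf x ->
  tangent_cone Omega (row_mx x 0) (row_mx d w) ->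
  dir_normal_cone Omega (row_mx x 0) (row_mx d w) =
    limiting_normal_cone Omega (row_mx x 0) /\
  limiting_normal_cone Omega (row_mx x 0) = pairset (fun u v => u = 0).
Proof.
move=> x0 qx T; have NE := limiting_normal_cone_eq (limiting_int x0 qx) (int_inner x0 qx T).
split=> //; rewrite NE; apply: dir_normal_cone_eq (int_inner x0 qx T).
by rewrite -NE; exact: dir_normal_cone_sub.
Qed.

Lemma smooth_case x y d w : 0 < hd x -> qf x = 0 -> 0 < hd y ->
  Omega (row_mx x y) -> tangent_cone Omega (row_mx x y) (row_mx d w) ->
  dir_normal_cone Omega (row_mx x y) (row_mx d w) =
    limiting_normal_cone Omega (row_mx x y).
Proof.
move=> x0 qx y0 Oxy T; have [_ _ _ yE] := soc_compl_chart x0 Oxy.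
have s0 := divr_gt0 y0 x0; move: yE T; set s := _ / _ in s0 * => -> T.
apply: dir_normal_cone_eq; first exact: dir_normal_cone_sub.
exact: smooth_limiting_sub_inner.
Qed.

Lemma corner_int_case x d : 0 < hd x -> qf x = 0 -> 0 < dot d (hat x) ->
  dir_normal_cone Omega (row_mx x 0) (row_mx d 0) = pairset (fun u v => u = 0).
Proof.
move=> x0 qx dx; apply: dir_normal_cone_eq; first exact: corner_dir_int.
apply: subset_pairs => u v; rewrite pairset_row_mx => ->.
by apply: inner_normal_int => //; right; rewrite ltW.
Qed.

Lemma corner_bd_case x d : 0 < hd x -> qf x = 0 -> dot d (hat x) = 0 ->
  dir_normal_cone Omega (row_mx x 0) (row_mx d 0) =
  limiting_normal_cone Omega (row_mx x 0).
Proof.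
move=> x0 qx dx; apply: dir_normal_cone_eq; first exact: dir_normal_cone_sub.
exact: corner_limiting_sub_inner.
Qed.

Lemma ray_pos x w : (ray x `\` [set 0]) w -> exists2 r, 0 < r & w = r *: x.
Proof.
move=> [[r /= r0 <-] w0]; exists r => //; rewrite lt_def r0 andbT.
by apply/eqP => r_0; apply: w0; rewrite /= r_0 scale0r.
Qed.

Lemma corner_smooth_case x d w : 0 < hd x -> qf x = 0 -> orth d (hat x) ->
  (ray (hat x) `\` [set 0]) w ->
  dir_normal_cone Omega (row_mx x 0) (row_mx d w) =
  pairset (fun u v => line (hat x) u /\ orth v (hat x)).
Proof.
move=> x0 qx dx /ray_pos[r r0 ->].
apply: dir_normal_cone_eq; first exact: corner_dir_smooth.
exact: (corner_smooth_inner x0 qx dx (ltW r0)).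
Qed.

Lemma corner_exhaustive x d w : 0 < hd x -> qf x = 0 ->
  tangent_cone Omega (row_mx x 0) (row_mx d w) ->
  [\/ (tangent_cone K x)° d /\ w = 0, bd (tangent_cone K x) d /\ w = 0
    | orth d (hat x) /\ (ray (hat x) `\` [set 0]) w].
Proof.
move=> x0 qx T.
case: (corner_tangent_cases x0 qx T) => [[dx ->]|[dx ->]|[dx [r r0 ->]]].
- by apply: Or31; split=> //; exact/interior_tangent_cone_soc.
- by apply: Or32; split=> //; exact/bd_tangent_cone_soc.
apply: Or33; split=> //; split; first by exists r => //; exact: ltW.
by move=> /= /eqP; rewrite scaler_eq0 gt_eqF//= (negbTE (hd_gt0_hat_neq0 x0)).
Qed.

Lemma limiting_eq_swap x y (P : V -> V -> Prop) :
  limiting_normal_cone Omega (row_mx x y) = pairset P ->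
  limiting_normal_cone Omega (row_mx y x) = pairset (fun u v => P v u).
Proof.
move=> E; apply/seteqP; split; apply: subset_pairs => u v;
  by rewrite pairset_row_mx limiting_normal_cone_swap E pairset_row_mx.
Qed.

Lemma dir_eq_swap x y d w (P : V -> V -> Prop) :
  dir_normal_cone Omega (row_mx x y) (row_mx d w) = pairset P ->
  dir_normal_cone Omega (row_mx y x) (row_mx w d) = pairset (fun u v => P v u).
Proof.
move=> E; apply/seteqP; split; apply: subset_pairs => u v;
  by rewrite pairset_row_mx dir_normal_cone_swap E pairset_row_mx.
Qed.

Lemma dir_limiting_eq_swap x y d w :
  dir_normal_cone Omega (row_mx x y) (row_mx d w) =
    limiting_normal_cone Omega (row_mx x y) ->
  dir_normal_cone Omega (row_mx y x) (row_mx w d) =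
    limiting_normal_cone Omega (row_mx y x).
Proof.
move=> E; apply/seteqP; split; apply: subset_pairs => u v;
  by rewrite dir_normal_cone_swap limiting_normal_cone_swap E.
Qed.

Lemma soc_cases x : K x ->
  [\/ x = 0, 0 < hd x /\ 0 < qf x | 0 < hd x /\ qf x = 0].
Proof.
move=> xK; have [] := (socP x).1 xK.
rewrite le_eqVlt => /orP[/eqP/esym/(soc_hd_eq0 xK) -> _|x0]; first exact: Or31.
by rewrite le_eqVlt => /orP[/eqP/esym qx|qx]; [apply: Or33|apply: Or32].
Qed.

(** Of the nine combinations of zero, interior and boundary, the excluded ones contradict
    [hd y * qf x = 0] or its mirror image. *)
Lemma soc_compl_cases x y : Omega (row_mx x y) ->
  let bdK0 := bd K `\` [set 0] in
  (x = 0 /\ K° y) \/ (K° x /\ y = 0) \/ (bdK0 x /\ bdK0 y) \/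
  (bdK0 x /\ y = 0) \/ (x = 0 /\ bdK0 y) \/ (x = 0 /\ y = 0).
Proof.
move=> Oxy bdK0; rewrite {}/bdK0 !bd_soc0 !interior_soc.
have := Oxy; rewrite /soc_compl pairset_row_mx => -[xK yK xy].
have [_ hq] := soc_compl_eq xK yK xy; rewrite dotC in xy.
have [_ hq'] := soc_compl_eq yK xK xy.
have eq0 (a b : R) : 0 < a -> 0 < b -> a * b = 0 -> False.
  by move=> a0 b0 ab; have := mulr_gt0 a0 b0; rewrite ab ltxx.
case: (soc_cases xK) => [x0|[x0 qx]|[x0 qx]];
  case: (soc_cases yK) => [y0|[y0 qy]|[y0 qy]]; try tauto;
  exfalso; first [exact: (eq0 _ _ y0 qx hq)|exact: (eq0 _ _ x0 qy hq')].
Qed.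

Lemma origin_case (e : VV) :
  dir_normal_cone Omega 0 e = limiting_normal_cone Omega e.
Proof.
have OZ := @soc_complZ R n.
apply: dir_normal_cone_eq; first exact: dir_sub_limiting_normal_cone0.
exact: limiting_sub_inner_dir_normal_cone0.
Qed.

End Cases.

Theorem theorem6p1 (R : realType) (n : nat) :
  let K : set 'rV[R]_n.+1 := @soc R n in
  let bdK0 : set 'rV[R]_n.+1 := bd K `\` [set 0] in
  let Omega : set 'rV[R]_(n.+1 + n.+1) := @soc_compl R n in
  directionally_regular Omega /\
  forall x y : 'rV[R]_n.+1, Omega (row_mx x y) ->
  let z := row_mx x y in
  [/\ tangent_cone Omega z = inner_tangent_cone Omega z,
      (* the six cases cover Omega *)
      (x = 0 /\ K° y) \/ (K° x /\ y = 0) \/ (bdK0 x /\ bdK0 y) \/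
      (bdK0 x /\ y = 0) \/ (x = 0 /\ bdK0 y) \/ (x = 0 /\ y = 0)
    & forall d w : 'rV[R]_n.+1, tangent_cone Omega z (row_mx d w) ->
      let Ndir := dir_normal_cone Omega z (row_mx d w) in
      let N := limiting_normal_cone Omega z in
      (* Case 1 *)
      (x = 0 -> K° y ->
         Ndir = N /\ N = pairset (fun u v => v = 0)) /\
      (* Case 2 *)
      (K° x -> y = 0 ->
         Ndir = N /\ N = pairset (fun u v => u = 0)) /\
      (* Case 3 *)
      (bdK0 x -> bdK0 y -> Ndir = N) /\
      (* Case 4 *)
      (bdK0 x -> y = 0 ->
         [/\ (tangent_cone K x)° d -> w = 0 ->
               Ndir = pairset (fun u v => u = 0),
             bd (tangent_cone K x) d -> w = 0 -> Ndir = N,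
             orth d (hat x) -> (ray (hat x) `\` [set 0]) w ->
               Ndir = pairset (fun u v => line (hat x) u /\ orth v (hat x))
           & [\/ (tangent_cone K x)° d /\ w = 0,
                 bd (tangent_cone K x) d /\ w = 0
               | orth d (hat x) /\ (ray (hat x) `\` [set 0]) w]]) /\
      (* Case 5 *)
      (x = 0 -> bdK0 y ->
         [/\ d = 0 -> (tangent_cone K y)° w ->
               Ndir = pairset (fun u v => v = 0),
             d = 0 -> bd (tangent_cone K y) w -> Ndir = N,
             (ray (hat y) `\` [set 0]) d -> orth w (hat y) ->
               Ndir = pairset (fun u v => line (hat y) v /\ orth u (hat y))
           & [\/ d = 0 /\ (tangent_cone K y)° w,
                 d = 0 /\ bd (tangent_cone K y) w
               | (ray (hat y) `\` [set 0]) d /\ orth w (hat y)]]) /\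
      (* Case 6 *)
      (x = 0 -> y = 0 ->
         Ndir = limiting_normal_cone Omega (row_mx d w))].
Proof.
move=> K bdK0 Omega; split; first exact: soc_compl_directionally_regular.
move=> x y Oxy z; split.
- by apply: directionally_regular_tangent => //; exact: soc_compl_directionally_regular.
- exact: soc_compl_cases.
move=> d w; rewrite /z => T; cbv zeta; clear z.
split; [|split; [|split; [|split; [|split]]]].
(* The cases with [x = 0] and [y] nonzero are obtained from those with [y = 0] by the swap. *)
- move=> x0 /interior_soc[y0 qy]; rewrite {}x0 in T *.
  have [DN NE] := int_case y0 qy (tangent_cone_swap T).
  by split; [exact: dir_limiting_eq_swap|exact: limiting_eq_swap NE].
- by move=> /interior_soc[x0 qx] y0; rewrite {}y0 in T *; exact: int_case.
- by move=> /bd_soc0[x0 qx] /bd_soc0[y0 _]; exact: smooth_case.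
- move=> /bd_soc0[x0 qx] y0; rewrite {}y0 in T *; split.
  + by move=> /(interior_tangent_cone_soc _ x0 qx) dx ->; exact: corner_int_case.
  + by move=> /(bd_tangent_cone_soc _ x0 qx) dx ->; exact: corner_bd_case.
  + exact: corner_smooth_case.
  + exact: corner_exhaustive.
- move=> x0 /bd_soc0[y0 qy]; rewrite {}x0 in T *; split.
  + move=> -> /(interior_tangent_cone_soc _ y0 qy) wy.
    exact: dir_eq_swap (corner_int_case y0 qy wy).
  + move=> -> /(bd_tangent_cone_soc _ y0 qy) wy.
    exact: dir_limiting_eq_swap (corner_bd_case y0 qy wy).
  + by move=> dy wy; exact: dir_eq_swap (corner_smooth_case y0 qy wy dy).
  + case: (corner_exhaustive y0 qy (tangent_cone_swap T)) => -[? ?];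
      [exact: Or31|exact: Or32|exact: Or33].
- by move=> -> ->; rewrite row_mx0; exact: origin_case.
Qed.
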